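(* Let $\mathcal{I}$ be any one of $\mathcal{P}$, $\mathcal{P}_\infty$, $\mathcal{B}$. The isometry class $\{\mu\in\mathcal{I}: X_\mu$ has the SD2P$\}$ is $G_\delta$-complete in $\mathcal{I}$.
   Context: Coding: $V$ is the set of finitely supported rational sequences; $\mathcal{P}\subset\mathbb{R}^V$ the seminorms on $V$ with pointwise convergence topology; for $\mu\in\mathcal{P}$, $\bar\mu$ is its seminorm extension to $c_{00}$ and $X_\mu$ the completion of $c_{00}/\{\bar\mu=0\}$; $\mathcal{P}_\infty=\{\mu:\dim X_\mu=\infty\}$, $\mathcal{B}=\{\mu\in\mathcal{P}_\infty:\bar\mu$ a norm on $c_{00}\}$, subspace topologies. SD2P: every convex combination of slices $\{x\in B_X:f(x)>1-\alpha\}$ ($f\in S_{X^*}$, $\alpha>0$) of $B_X$ has diameter 2. A set $A$ in a Polish space $Z$ is $G_\delta$-complete if it is $G_\delta$ and every $G_\delta$ subset of every zero-dimensional Polish space is a continuous preimage of $A$. *)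

(* Defs.v *)
From HB Require Import structures.
From mathcomp Require Import all_boot all_order all_algebra.
From mathcomp Require Import all_classical all_reals all_analysis borel_hierarchy.
Set Implicit Arguments. Unset Strict Implicit. Unset Printing Implicit Defensive.
Import Order.TTheory GRing.Theory Num.Theory.
Import numFieldNormedType.Exports.
Local Open Scope classical_set_scope.
Local Open Scope ring_scope.

Definition finsupp {T : zmodType} (x : nat -> T) :=
  exists N : nat, forall i : nat, (N <= i)%N -> x i = 0.

Definition V := {v : nat -> rat | finsupp v}.

Definition c00 (R : realType) := {x : nat -> R | finsupp x}.

Definition seminormV (R : realType) (mu : V -> R) :=
  (forall u v w : V, proj1_sig u = (fun i => proj1_sig v i + proj1_sig w i) ->
       mu u <= mu v + mu w) /\
  (forall (q : rat) (u v : V), proj1_sig u = (fun i => q * proj1_sig v i) ->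
       mu u = ratr `|q| * mu v).

Definition RV (R : realType) : topologicalType := {ptws V -> R}.

Definition approx_seq (R : realType) (n : nat) (x : c00 R) : nat -> rat :=
  fun i => ((Num.floor (n.+1%:R * proj1_sig x i))%:~R / n.+1%:R : rat).

Lemma approx_finsupp (R : realType) (n : nat) (x : c00 R) :
  finsupp (approx_seq n x).
Proof.
case: (proj2_sig x) => N HN; exists N => i Hi.
by rewrite /approx_seq HN // mulr0 floor0 mul0r.
Qed.

Definition approx (R : realType) (n : nat) (x : c00 R) : V :=
  exist _ (approx_seq n x) (approx_finsupp n x).

(** mubar : the (unique, continuous) seminorm extension of mu to c00 *)
Definition mubar (R : realType) (mu : V -> R) (x : c00 R) : R :=
  limn (fun n => mu (approx n x)).

(** (X, j) is a completion of c00 / {mubar = 0}: j is linear on c00,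
    isometric for mubar, with dense range in the Banach space X. *)
Definition is_completion (R : realType) (mu : V -> R)
    (X : completeNormedModType R) (j : (nat -> R) -> X) :=
  (forall (a : R) (x y : nat -> R), finsupp x -> finsupp y ->
     j (fun i => a * x i + y i) = a *: j x + j y) /\
  (forall x : c00 R, `|j (proj1_sig x)| = mubar mu x) /\
  closure (j @` [set x | finsupp x]) = [set: X].

(** X_mu has property Q (Q is invariant under isometric isomorphisms) *)
Definition Xmu_has (R : realType) (mu : V -> R)
    (Q : completeNormedModType R -> Prop) :=
  exists (X : completeNormedModType R) (j : (nat -> R) -> X),
    is_completion mu j /\ Q X.

Definition infinite_dim (R : realType) (X : completeNormedModType R) :=
  forall n : nat, exists x : 'I_n -> X,
    forall c : 'I_n -> R, \sum_(i < n) c i *: x i = 0 -> forall i, c i = 0.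

Definition dual_sphere (R : realType) (X : completeNormedModType R)
    (f : X -> R) :=
  (forall (a : R) (x y : X), f (a *: x + y) = a * f x + f y) /\
  continuous f /\
  ereal_sup [set (`|f x|)%:E | x in [set x : X | `|x| <= 1]] = 1%E.

Definition slice (R : realType) (X : completeNormedModType R)
    (f : X -> R) (alpha : R) : set X :=
  [set x | `|x| <= 1 /\ 1 - alpha < f x].

Definition diam (R : realType) (X : completeNormedModType R) (C : set X) :=
  ereal_sup [set (`|x - y|)%:E | x in C & y in C].

Definition SD2P (R : realType) (X : completeNormedModType R) :=
  forall (n : nat) (lam : 'I_n.+1 -> R) (f : 'I_n.+1 -> X -> R)
         (alpha : 'I_n.+1 -> R),
    (forall i, 0 <= lam i) -> \sum_(i < n.+1) lam i = 1 ->
    (forall i, dual_sphere (f i)) -> (forall i, 0 < alpha i) ->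
    diam [set x | exists s : 'I_n.+1 -> X,
            (forall i, slice (f i) (alpha i) (s i)) /\
            x = \sum_(i < n.+1) lam i *: s i] = 2%:E.

Definition Pset (R : realType) : set (RV R) := [set mu | seminormV mu].
Arguments Pset : clear implicits.
Definition Pinf (R : realType) : set (RV R) :=
  [set mu | Pset R mu /\ Xmu_has mu (@infinite_dim R)].
Arguments Pinf : clear implicits.
Definition Bset (R : realType) : set (RV R) :=
  [set mu | Pinf R mu /\ forall x : c00 R, mubar mu x = 0 -> proj1_sig x = (fun=> 0)].
Arguments Bset : clear implicits.

Definition SD2Pset (R : realType) : set (RV R) :=
  [set mu | Xmu_has mu (@SD2P R)].
Arguments SD2Pset : clear implicits.

Definition polish (R : realType) (Y : topologicalType) :=
  (exists D : set Y, countable D /\ closure D = [set: Y]) /\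
  exists d : Y -> Y -> R,
    (forall x y, d x y = 0 <-> x = y) /\
    (forall x y, d x y = d y x) /\
    (forall x y z, d x z <= d x y + d y z) /\
    (forall U : set Y, open U <->
        forall x, U x -> exists2 e : R, 0 < e & [set z | d x z < e] `<=` U) /\
    (forall u : nat -> Y,
        (forall e : R, 0 < e -> exists N : nat, forall m n : nat,
            (N <= m)%N -> (N <= n)%N -> d (u m) (u n) < e) ->
        exists l : Y, forall e : R, 0 < e -> exists N : nat, forall n : nat,
            (N <= n)%N -> d (u n) l < e).

Definition zero_dim (Y : topologicalType) :=
  forall (x : Y) (U : set Y), open U -> U x ->
    exists C : set Y, clopen C /\ C x /\ C `<=` U.

Definition Gdelta_complete (R : realType) (Z : topologicalType)
    (I A : set Z) :=
  (exists G : set Z, Gdelta G /\ A = I `&` G) /\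
  forall (Y : topologicalType), polish R Y -> zero_dim Y ->
    forall C : set Y, Gdelta C ->
      exists f : Y -> Z, continuous f /\ (forall y, I (f y)) /\
        f @^-1` A = C.

(* Main.v *)
Require Import Defs.
From HB Require Import structures.
From mathcomp Require Import all_boot all_order all_algebra.
From mathcomp Require Import generic_quotient.
From mathcomp Require Import all_classical all_reals all_analysis.
From mathcomp Require Import borel_hierarchy.
From mathcomp Require Import ring lra.
Set Implicit Arguments. Unset Strict Implicit. Unset Printing Implicit Defensive.
Import Order.TTheory GRing.Theory Num.Theory.
Import numFieldNormedType.Exports.
Local Open Scope classical_set_scope.
Local Open Scope ring_scope.

(* X_mu fails the SD2P exactly when, for some rational d in ]0, 1[ and some
   natural weights k_i, there are functionals phi_i in the dual ball, of norm at
   least 1 - d as witnessed by given rational vectors v_i, such that the weighted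
   sum of the slices {phi_i > 1 - 2d} has diameter at most (2 - d) times the total
   weight.  For fixed (d, k, v) this is the projection of a closed set of pairs
   (mu, phi) along the phi, which range over a compact set, hence a closed
   condition on mu; only countably many (d, k, v) occur, so the SD2P is G_delta.
   For completeness, t : nat -> nat partitions the coordinates into blocks, and
   the l_1 norm inside blocks with the supremum over blocks defines a norm on
   finitely supported sequences.  If t is unbounded, a unit vector in a far block
   can be added to and subtracted from all points of finitely many slices at once,
   so the SD2P holds.  If t is bounded, the average of one coordinate per block has
   slices of diameter less than 2.  A G_delta set C of a zero-dimensional space is
   the set of y for which t(y) is unbounded, for some t with each t(y)_k locally
   constant in y. *)

(** * Completion of a seminormed space *)

Record seminorm (R : realType) (W : lmodType R) := Seminorm {
  seminorm_val :> W -> R;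
  seminormZ : forall a x, seminorm_val (a *: x) = `|a| * seminorm_val x;
  seminormD : forall x y, seminorm_val (x + y) <= seminorm_val x + seminorm_val y
}.

Local Open Scope quotient_scope.

(** * The normed quotient of a seminormed space *)

Section SeminormTheory.
Variables (R : realType) (W : lmodType R) (N : seminorm W).
Implicit Types x y : W.

Lemma seminorm0 : N 0 = 0.
Proof. by rewrite -(scale0r 0) seminormZ normr0 mul0r. Qed.

Lemma seminormN x : N (- x) = N x.
Proof. by rewrite -scaleN1r seminormZ normrN1 mul1r. Qed.

Lemma seminormB x y : N (x - y) = N (y - x).
Proof. by rewrite -seminormN opprB. Qed.

Lemma seminorm_ge0 x : 0 <= N x.
Proof. by have := seminormD N x (- x); rewrite subrr seminorm0 seminormN; lra. Qed.

Lemma seminorm_triangle y x z : N (x - z) <= N (x - y) + N (y - z).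
Proof. by have := seminormD N (x - y) (y - z); rewrite addrA subrK. Qed.

Lemma seminorm_dist x y : `|N x - N y| <= N (x - y).
Proof.
rewrite ler_norml; have := seminormD N (x - y) y; have := seminormD N (y - x) x.
by rewrite !subrK (seminormB y); lra.
Qed.

Definition null_rel (x y : W) : bool := N (x - y) == 0.

Lemma null_rel_refl : reflexive null_rel.
Proof. by move=> x; rewrite /null_rel subrr seminorm0. Qed.

Lemma null_rel_sym : symmetric null_rel.
Proof. by move=> x y; rewrite /null_rel seminormB. Qed.

Lemma null_rel_trans : transitive null_rel.
Proof.
move=> y x z /eqP xy /eqP yz; rewrite /null_rel eq_le seminorm_ge0 andbT.
by rewrite (le_trans (seminorm_triangle y x z))// xy yz addr0.
Qed.

Canonical null_equiv := EquivRel null_rel null_rel_refl null_rel_sym null_rel_trans.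

Definition normed_quotient := {eq_quot null_equiv}.
Local Notation Q := normed_quotient.
HB.instance Definition _ := Choice.on Q.
HB.instance Definition _ := Quotient.on Q.
HB.instance Definition _ := EqQuotient.on Q.

Definition to_quotient (x : W) : Q := \pi_Q x.

Lemma to_quotient_surj (y : Q) : exists x, y = to_quotient x.
Proof. by exists (repr y); rewrite /to_quotient reprK. Qed.

Lemma eq_to_quotient x y : to_quotient x = to_quotient y <-> N (x - y) = 0.
Proof. by split => [/eqmodP/eqP//|/eqP h]; apply/eqmodP. Qed.

Let reprP x : N (repr (to_quotient x) - x) = 0.
Proof. by apply/eq_to_quotient; rewrite /to_quotient reprK. Qed.

(** The operations go through chosen representatives; the compatibility lemmas with [to_quotient]
    below transport the axioms from [W]. *)
Definition quotient_add (x y : Q) : Q := to_quotient (repr x + repr y).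
Definition quotient_opp (x : Q) : Q := to_quotient (- repr x).
Definition quotient_scale (a : R) (x : Q) : Q := to_quotient (a *: repr x).
Definition quotient_norm (x : Q) : R := N (repr x).

Let add_to_quotient x y :
  quotient_add (to_quotient x) (to_quotient y) = to_quotient (x + y).
Proof.
apply/eq_to_quotient/le_anti; rewrite seminorm_ge0 andbT opprD addrACA.
by rewrite (le_trans (seminormD _ _ _))// !reprP addr0.
Qed.

Let opp_to_quotient x : quotient_opp (to_quotient x) = to_quotient (- x).
Proof. by apply/eq_to_quotient; rewrite -opprD seminormN reprP. Qed.

Let scale_to_quotient a x : quotient_scale a (to_quotient x) = to_quotient (a *: x).
Proof. by apply/eq_to_quotient; rewrite -scalerBr seminormZ reprP mulr0. Qed.

Let norm_to_quotient_subproof x : quotient_norm (to_quotient x) = N x.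
Proof.
apply/eqP; rewrite -subr_eq0 -normr_eq0 eq_le normr_ge0 andbT.
by rewrite (le_trans (seminorm_dist _ _))// reprP.
Qed.

Let quotient_addA : associative quotient_add.
Proof.
move=> x y z; have [[a ->] [b ->] [c ->]] :=
  And3 (to_quotient_surj x) (to_quotient_surj y) (to_quotient_surj z).
by rewrite !add_to_quotient addrA.
Qed.

Let quotient_addC : commutative quotient_add.
Proof.
move=> x y; have [[a ->] [b ->]] := (to_quotient_surj x, to_quotient_surj y).
by rewrite !add_to_quotient addrC.
Qed.

Let quotient_add0 : left_id (to_quotient 0) quotient_add.
Proof. by move=> x; have [a ->] := to_quotient_surj x; rewrite add_to_quotient add0r. Qed.

Let quotient_addN : left_inverse (to_quotient 0) quotient_opp quotient_add.
Proof.
move=> x; have [a ->] := to_quotient_surj x.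
by rewrite opp_to_quotient add_to_quotient addNr.
Qed.

HB.instance Definition _ := GRing.isZmodule.Build Q
  quotient_addA quotient_addC quotient_add0 quotient_addN.

Let to_quotientD x y : to_quotient (x + y) = to_quotient x + to_quotient y.
Proof. by rewrite -add_to_quotient. Qed.

Let quotient_scaleA a b (x : Q) :
  quotient_scale a (quotient_scale b x) = quotient_scale (a * b) x.
Proof.
by have [y ->] := to_quotient_surj x; rewrite !scale_to_quotient scalerA.
Qed.

Let quotient_scale1 : left_id 1 quotient_scale.
Proof.
by move=> x; have [y ->] := to_quotient_surj x; rewrite scale_to_quotient scale1r.
Qed.

Let quotient_scaleDr : right_distributive quotient_scale +%R.
Proof.
move=> a x y; have [[b ->] [c ->]] := (to_quotient_surj x, to_quotient_surj y).
by rewrite -to_quotientD !scale_to_quotient scalerDr to_quotientD.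
Qed.

Let quotient_scaleDl (x : Q) : {morph quotient_scale^~ x : a b / a + b}.
Proof.
move=> a b; have [y ->] := to_quotient_surj x.
by rewrite /= !scale_to_quotient scalerDl to_quotientD.
Qed.

HB.instance Definition _ := GRing.Zmodule_isLmodule.Build R Q
  quotient_scaleA quotient_scale1 quotient_scaleDr quotient_scaleDl.

Let to_quotient_linear : linear to_quotient.
Proof. by move=> a x y; rewrite to_quotientD -scale_to_quotient. Qed.

HB.instance Definition _ := GRing.isLinear.Build R W Q _ to_quotient to_quotient_linear.

Let quotient_normD (x y : Q) : quotient_norm (x + y) <= quotient_norm x + quotient_norm y.
Proof.
have [[a ->] [b ->]] := (to_quotient_surj x, to_quotient_surj y).
by rewrite -to_quotientD !norm_to_quotient_subproof seminormD.
Qed.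

Let quotient_normZ a (x : Q) : quotient_norm (a *: x) = `|a| * quotient_norm x.
Proof.
have [y ->] := to_quotient_surj x.
by rewrite -linearZ/= !norm_to_quotient_subproof seminormZ.
Qed.

Let quotient_norm_eq0 (x : Q) : quotient_norm x = 0 -> x = 0.
Proof.
have [y ->] := to_quotient_surj x; rewrite norm_to_quotient_subproof => y0.
by apply/eq_to_quotient; rewrite subr0.
Qed.

HB.instance Definition _ := Lmodule_isNormed.Build R Q
  quotient_normD quotient_normZ quotient_norm_eq0.

Lemma norm_to_quotient x : `|to_quotient x| = N x.
Proof. exact: norm_to_quotient_subproof. Qed.

End SeminormTheory.

(** * Cauchy sequences modulo null sequences *)

Section Completion.
Variables (R : realType) (W : lmodType R) (N : seminorm W).

Definition seminorm_cauchy (u : nat -> W) :=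
  forall e : R, 0 < e -> exists K : nat, forall m n : nat,
    (K <= m)%N -> (K <= n)%N -> N (u m - u n) <= e.

(** As a predicate closed under linear combinations, it lets the Cauchy sequences inherit the module
    structure of [nat -> W]. *)
Definition cauchy_pred : {pred nat -> W} := fun u => `[<seminorm_cauchy u>].

Lemma cauchy_pred_submod : submod_closed cauchy_pred.
Proof.
split; first by apply/asboolP => e e0; exists 0%N => m n _ _; rewrite subrr seminorm0 ltW.
move=> a u v /asboolP uC /asboolP vC; apply/asboolP => e e0.
(* The [+ 1] keeps the divisor positive when [a] is 0. *)
have e1 : 0 < e / 2 / (`|a| + 1) by rewrite !divr_gt0// ltr_wpDl.
have [K uK] := uC _ e1; have e2 : 0 < e / 2 by rewrite divr_gt0.
have [L vL] := vC _ e2.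
exists (maxn K L) => m n; rewrite !geq_max => /andP[Km Lm] /andP[Kn Ln].
rewrite [X in N X](_ : _ = a *: (u m - u n) + (v m - v n)); last first.
  by rewrite scalerBr opprD addrACA.
rewrite (le_trans (seminormD _ _ _))// seminormZ (splitr e) lerD ?vL//.
rewrite (@le_trans _ _ ((`|a| + 1) * (e / 2 / (`|a| + 1))))//.
  by rewrite ler_pM ?normr_ge0 ?seminorm_ge0 ?uK// lerDl.
by rewrite mulrC divfK// gt_eqF// ltr_wpDl.
Qed.

HB.instance Definition _ := GRing.isSubmodClosed.Build R (nat -> W) cauchy_pred
  cauchy_pred_submod.

Record cauchy_seq := CauchySeq {
  cauchy_seq_val :> nat -> W;
  cauchy_seqP : cauchy_seq_val \in cauchy_pred
}.
HB.instance Definition _ := [isSub for cauchy_seq_val].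
HB.instance Definition _ := gen_eqMixin cauchy_seq.
HB.instance Definition _ := gen_choiceMixin cauchy_seq.
HB.instance Definition _ := [SubChoice_isSubLmodule of cauchy_seq by <:].

Definition lim_norm (u : cauchy_seq) : R := limn (fun n => N (u n)).

Lemma cauchy_seq_cvg (u : cauchy_seq) : (fun n => N (u n)) @ \oo --> lim_norm u.
Proof.
apply/cauchy_cvgP/cauchyP => /= e e0.
have /asboolP/(_ (e / 2))[|K uK] := cauchy_seqP u; first by rewrite divr_gt0.
exists (N (u K)); exists K => // n /= Kn.
rewrite /ball/= (le_lt_trans (seminorm_dist _ _ _))// (le_lt_trans (uK _ _ _ _))//.
by rewrite ltr_pdivrMr// ltr_pMr// ltr1n.
Qed.

Arguments cauchy_seq_cvg : clear implicits.

Lemma lim_normZ a (u : cauchy_seq) : lim_norm (a *: u) = `|a| * lim_norm u.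
Proof.
apply/(cvg_lim (@Rhausdorff R)).
rewrite [X in X @ _](_ : _ = fun n => `|a| * N (u n)); last first.
  by apply/funext => n; rewrite -seminormZ.
by apply: cvgMr; exact: cauchy_seq_cvg.
Qed.

Lemma lim_normD (u v : cauchy_seq) : lim_norm (u + v) <= lim_norm u + lim_norm v.
Proof.
apply: (ler_cvg_to (cauchy_seq_cvg (u + v))
  (cvgD (cauchy_seq_cvg u) (cauchy_seq_cvg v))).
by apply: nearW => n; exact: seminormD.
Qed.

Definition lim_seminorm := Seminorm lim_normZ lim_normD.

(** Cauchy sequences modulo those along which [N] tends to 0; null vectors of [N] are identified
    with 0 at the same time. *)
Definition completion := normed_quotient lim_seminorm.

HB.instance Definition _ := NormedModule.on completion.

Lemma const_cauchy (x : W) : (fun=> x) \in cauchy_pred.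
Proof. by apply/asboolP => e e0; exists 0%N => m n _ _; rewrite subrr seminorm0 ltW. Qed.

Definition to_completion (x : W) : completion :=
  to_quotient lim_seminorm (CauchySeq (const_cauchy x)).

Lemma to_completion_linear : linear to_completion.
Proof.
move=> a x y; rewrite /to_completion -linearP; congr to_quotient.
exact/val_inj.
Qed.

HB.instance Definition _ := GRing.isLinear.Build R W completion _ to_completion
  to_completion_linear.

Lemma norm_to_completion x : `|to_completion x| = N x.
Proof.
rewrite norm_to_quotient; apply: (cvg_lim (@Rhausdorff R)).
exact: (@cvg_cst R (N x) nat \oo).
Qed.

Lemma to_completion_near (u : cauchy_seq) (e : R) (K : nat) :
  (forall m, (K <= m)%N -> N (u K - u m) <= e) ->
  `|to_quotient lim_seminorm u - to_completion (u K)| <= e.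
Proof.
move=> uK; rewrite -linearB norm_to_quotient/=.
apply: (ler_cvg_to (cauchy_seq_cvg (u - CauchySeq (const_cauchy (u K))))
  (cvg_cst e)).
by exists K => // m /= /uK; rewrite seminormB.
Qed.

Lemma to_completion_dense (x : completion) (e : R) : 0 < e ->
  exists y, `|x - to_completion y| <= e.
Proof.
move=> e0; have [u ->] := to_quotient_surj x.
have /asboolP/(_ _ e0)[K uK] := cauchy_seqP u.
by exists (u K); apply: to_completion_near => m; exact: uK.
Qed.

(** For each n the filter contains the ball of radius 2/(n+1) about some [to_completion (u n)].
    Members of a proper filter meet, so [u] is Cauchy, and the filter converges to the class of
    [u]. *)
Lemma completion_complete (F : set_system completion) :
  ProperFilter F -> cauchy F -> cvg F.
Proof.
move=> FF /cauchyP Fc.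
pose d n : R := n.+1%:R^-1.
have d0 n : 0 < d n by rewrite invr_gt0.
have /choice[u uP] n : exists y, F (ball (to_completion y) (d n + d n)).
  have [x Fx] := Fc (d n) (d0 n); have [y yx] := to_completion_dense x (d0 n).
  exists y; apply: filterS Fx => z xz; rewrite -ball_normE/= distrC.
  rewrite (le_lt_trans (ler_distD x _ _))// -addrC ler_ltD// distrC.
  by move: xz; rewrite -ball_normE/=.
have uD m n : N (u m - u n) <= d m + d m + (d n + d n).
  have [z [zm zn]] := filter_ex (filterI (uP m) (uP n)).
  rewrite -norm_to_completion linearB (le_trans (ler_distD z _ _))// lerD//.
    by move: zm; rewrite -ball_normE/= => /ltW.
  by move: zn; rewrite -ball_normE/= distrC => /ltW.
have dle e K n : 0 < e -> 4 / e <= K%:R -> (K <= n)%N -> d n + d n + (d n + d n) <= e.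
  move=> e0 Ke Kn; rewrite (_ : _ + _ = 4 * d n); last by ring.
  rewrite ler_pdivrMr// mulrC -ler_pdivrMr// (le_trans Ke)// ler_nat.
  exact: leq_trans Kn _.
have uC : u \in cauchy_pred.
  apply/asboolP => e e0; have /archi_boundP := ltW (divr_gt0 (ltr0n R 4) e0).
  set K := Num.bound _ => /ltW Ke; exists K => m n Km Kn.
  have := uD m n; have := dle _ _ _ e0 Ke Km; have := dle _ _ _ e0 Ke Kn; lra.
apply/cvg_ex; exists (to_quotient lim_seminorm (CauchySeq uC)).
apply/cvgrPdist_le => e e0.
(* [K] is taken for e/2: one half is spent between the class of [u] and [u K], the other between
   [u K] and [z]. *)
have /archi_boundP := ltW (divr_gt0 (ltr0n R 4) (divr_gt0 e0 (ltr0n R 2))).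
set K := Num.bound _ => /ltW Ke.
have dK := dle _ _ _ (divr_gt0 e0 (ltr0n R 2)) Ke (leqnn K).
near=> z.
rewrite (le_trans (ler_distD (to_completion (u K)) _ _))// (splitr e) lerD//.
  apply: (@to_completion_near (CauchySeq uC)) => m Km /=.
  have := uD K m; have := dle _ _ _ (divr_gt0 e0 (ltr0n R 2)) Ke Km; lra.
have : ball (to_completion (u K)) (d K + d K) z by near: z; exact: uP.
rewrite -ball_normE/= => /ltW/le_trans; apply; have := d0 K; lra.
Unshelve. all: by end_near. Qed.

HB.instance Definition _ := Uniform_isComplete.Build completion completion_complete.

End Completion.

(** * The extension of a rational seminorm *)

Lemma finsupp_polyseq (T : nzRingType) (p : {poly T}) : finsupp (fun i => p`_i).
Proof. by exists (size p) => i; exact: nth_default. Qed.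

Lemma finsupp_poly (T : nzRingType) (x : nat -> T) : finsupp x ->
  exists p : {poly T}, x = (fun i => p`_i).
Proof.
move=> [N xN]; exists (\poly_(i < N) x i); apply/funext => i.
by rewrite coef_poly; case: ltnP => // /xN.
Qed.

Lemma sig_eq (T : Type) (P : T -> Prop) (u v : {x | P x}) :
  proj1_sig u = proj1_sig v -> u = v.
Proof. by case: u v => [u Pu] [v Pv] /= uv; exact: eq_exist. Qed.

(** Polynomials stand for finitely supported sequences: they carry a module structure, [size] bounds
    the support, and [{poly rat}] is countable. *)
Definition toV (p : {poly rat}) : V := exist _ _ (finsupp_polyseq p).

Lemma toV_surj (v : V) : exists p, v = toV p.
Proof. by have [p vp] := finsupp_poly (proj2_sig v); exists p; exact: sig_eq. Qed.

Definition toc00 (R : realType) (p : {poly R}) : c00 R := exist _ _ (finsupp_polyseq p).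

Lemma toc00_surj (R : realType) (x : c00 R) : exists p, x = toc00 p.
Proof. by have [p xp] := finsupp_poly (proj2_sig x); exists p; exact: sig_eq. Qed.

Section Rational_approximation.
Variable R : realType.

Definition rat_approx (n : nat) (a : R) : rat :=
  (Num.floor (n.+1%:R * a))%:~R / n.+1%:R.

Lemma rat_approxP n a : `|ratr (rat_approx n a) - a| <= n.+1%:R^-1 :> R.
Proof.
rewrite fmorph_div/= ratr_int ratr_nat.
have n0 : 0 < n.+1%:R :> R by [].
rewrite -[X in _ - X](mulKf (lt0r_neq0 n0)) mulrC -mulrBr normrM gtr0_norm ?invr_gt0//.
rewrite ler_piMr ?invr_ge0// ler_norml.
have /andP[] := real_floor_itv (num_real (n.+1%:R * a)).
by rewrite intrD1; lra.
Qed.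

Lemma rat_approx_cvg a : ratr (rat_approx n a) @[n --> \oo] --> a.
Proof.
apply/cvgrPdist_le => e e0; have := near_infty_natSinv_lt (PosNum e0).
by apply: filterS => n /ltW; rewrite distrC; exact/le_trans/rat_approxP.
Qed.

End Rational_approximation.

Section Rational_seminorm.
Variables (R : realType) (mu : V -> R).
Hypothesis muP : seminormV mu.
Local Notation m p := (mu (toV p)).
Implicit Types p q : {poly rat}.

Lemma seminormV_D p q : m (p + q) <= m p + m q.
Proof. by apply: muP.1; apply/funext => i /=; rewrite coefD. Qed.

Lemma seminormV_Z a p : m (a *: p) = `|ratr a| * m p.
Proof. by rewrite -ratr_norm; apply: muP.2; apply/funext => i /=; rewrite coefZ. Qed.

Lemma seminormV_0 : m 0 = 0.
Proof. by rewrite -(scale0r 0) seminormV_Z rmorph0 normr0 mul0r. Qed.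

Lemma seminormV_N p : m (- p) = m p.
Proof. by rewrite -scaleN1r seminormV_Z rmorphN1 normrN1 mul1r. Qed.

Lemma seminormV_ge0 p : 0 <= m p.
Proof. by have := seminormV_D p (- p); rewrite subrr seminormV_0 seminormV_N; lra. Qed.

Lemma seminormV_dist p q : `|m p - m q| <= m (p - q).
Proof.
rewrite ler_norml; have := seminormV_D (p - q) q; have := seminormV_D (q - p) p.
by rewrite !subrK -(seminormV_N (q - p)) opprB; lra.
Qed.

Let monomials K := \sum_(i < K) m 'X^i.

(** By the triangle inequality over monomials, on vectors supported below K a seminorm is dominated
    by a multiple of the sup norm. This is why [mu] extends continuously to real coefficients. *)
Lemma seminormV_le_coef K p e : (size p <= K)%N ->
  (forall i, `|ratr p`_i| <= e) -> m p <= e * monomials K.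
Proof.
move=> pK pe; have -> : p = \sum_(i < K) p`_i *: 'X^i.
  rewrite -poly_def; apply/polyP => i; rewrite coef_poly; case: ltnP => // Ki.
  by rewrite nth_default// (leq_trans pK).
rewrite mulr_sumr; elim/big_rec2 : _ => [|i y x _ xy]; first by rewrite seminormV_0.
rewrite (le_trans (seminormV_D _ _))// lerD// seminormV_Z ler_wpM2r// seminormV_ge0//.
Qed.

Lemma seminormV_near K p q (x : nat -> R) d e : (size p <= K)%N -> (size q <= K)%N ->
  (forall i, `|ratr p`_i - x i| <= d) -> (forall i, `|ratr q`_i - x i| <= e) ->
  `|m p - m q| <= (d + e) * monomials K.
Proof.
move=> pK qK px qx; rewrite (le_trans (seminormV_dist _ _))// seminormV_le_coef//.
  by rewrite (leq_trans (size_polyD _ _))// size_polyN geq_max pK.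
move=> i; rewrite coefB rmorphB/= (le_trans (ler_distD (x i) _ _))// lerD//.
by rewrite distrC.
Qed.

Definition poly_approx n (x : {poly R}) : {poly rat} :=
  \poly_(i < size x) rat_approx n x`_i.

Lemma approxE n (x : {poly R}) : Defs.approx n (toc00 x) = toV (poly_approx n x).
Proof.
apply: sig_eq; apply/funext => i /=; rewrite coef_poly; case: ltnP => // xi.
by rewrite /approx_seq/= nth_default// mulr0 floor0 mul0r.
Qed.

Lemma coef_poly_approx n (x : {poly R}) i : (poly_approx n x)`_i = rat_approx n x`_i.
Proof.
rewrite coef_poly; case: ltnP => // xi.
by rewrite /rat_approx nth_default// mulr0 floor0 mul0r.
Qed.

Lemma size_poly_approx n (x : {poly R}) : (size (poly_approx n x) <= size x)%N.
Proof. exact: size_poly. Qed.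

(** [mubar] is a [limn], which has meaning only once convergence is known. From rank K on, the
    approximations are within 2/(K+1) of the K-th one in each coordinate, hence Cauchy for [mu]. *)
Lemma mubar_cvg_approx (x : {poly R}) :
  m (poly_approx n x) @[n --> \oo] --> mubar mu (toc00 x).
Proof.
have -> : mubar mu (toc00 x) = limn (fun n => m (poly_approx n x)).
  by rewrite /mubar; congr (limn _); apply/funext => n; rewrite approxE.
apply/cauchy_cvgP/cauchyP => /= e e0.
have M0 : 0 <= monomials (size x) by apply: sumr_ge0 => i _; exact: seminormV_ge0.
near \oo => K; exists (m (poly_approx K x)); exists K => // n /= Kn.
rewrite /ball/=.
rewrite (le_lt_trans (@seminormV_near (size x) _ _ (fun i => x`_i)
  K.+1%:R^-1 K.+1%:R^-1 _ _ _ _)) ?size_poly_approx//.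
- by move=> i; rewrite coef_poly_approx rat_approxP.
- move=> i; rewrite coef_poly_approx (le_trans (rat_approxP _ _))//.
  by rewrite lef_pV2 ?posrE// ler_nat.
rewrite [X in X < _](_ : _ = 2 * monomials (size x) / K.+1%:R); last by ring.
rewrite ltr_pdivrMr// (mulrC e) -ltr_pdivrMr//.
apply: (@lt_trans _ _ K%:R); last by rewrite ltr_nat.
by near: K; exact: nbhs_infty_gtr.
Unshelve. all: by end_near. Qed.

(** Sums and multiples of floor approximations are not floor approximations, so the limit is needed
    along any rational vectors of bounded support that converge coordinatewise. *)
Lemma mubar_cvg K (r : nat -> {poly rat}) (x : {poly R}) :
  (forall n, (size (r n) <= K)%N) ->
  (forall i, ratr (r n)`_i @[n --> \oo] --> x`_i) ->
  m (r n) @[n --> \oo] --> mubar mu (toc00 x).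
Proof.
move=> rK rx; pose L := maxn K (size x).
have M0 : 0 <= monomials L by apply: sumr_ge0 => i _; exact: seminormV_ge0.
apply/cvgrPdist_le => e e0; pose d := e / (monomials L + 1).
have d0 : 0 < d by rewrite divr_gt0// ltr_wpDl.
have : \forall n \near \oo, forall i : 'I_L, `|ratr (r n)`_i - x`_i| <= d.
  apply: filter_forall => i; have /cvgrPdist_le/(_ _ d0) := rx i.
  by apply: filterS => n; rewrite distrC.
apply: filterS => n rn.
have {}rn i : `|ratr (r n)`_i - x`_i| <= d.
  have [iL|Li] := ltnP i L; first exact: (rn (Ordinal iL)).
  move: Li; rewrite geq_max => /andP[Ki xi].
  by rewrite !nth_default ?(leq_trans (rK n))// rmorph0 subrr normr0 ltW.
(* With n fixed, k tends to infinity, which replaces [m (poly_approx k x)] by [mubar]. *)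
have rxk k : `|m (poly_approx k x) - m (r n)| <= (k.+1%:R^-1 + d) * monomials L.
  apply: (@seminormV_near L _ _ (fun i => x`_i)) => //.
  - by rewrite (leq_trans (size_poly_approx _ _))// leq_maxr.
  - by rewrite (leq_trans (rK n))// leq_maxl.
  - by move=> i; rewrite coef_poly_approx rat_approxP.
have h1 : `|m (poly_approx k x) - m (r n)| @[k --> \oo] -->
    `|mubar mu (toc00 x) - m (r n)|.
  by apply: cvg_norm; apply: cvgB; [exact: mubar_cvg_approx|apply: cvg_cst].
have h2 : (k.+1%:R^-1 + d) * monomials L @[k --> \oo] --> (0 + d) * monomials L.
  by apply: cvgMl; apply: cvgD; [exact: cvg_harmonic|apply: cvg_cst].
apply: (le_trans (ler_cvg_to h1 h2 (nearW _ rxk))).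
by rewrite add0r /d mulrAC ler_pdivrMr ?ltr_wpDl// ler_pM2l// lerDl.
Qed.

Lemma mubar_rat p : mubar mu (toc00 (map_poly ratr p)) = m p.
Proof.
apply/esym/(@cvg_unique _ (@Rhausdorff R) (m p @[n --> \oo])); first by apply: cvg_cst.
apply: (@mubar_cvg (size p) (fun=> p)) => // i.
by rewrite coef_map/=; apply: cvg_cst.
Qed.

Lemma mubarD (x y : {poly R}) :
  mubar mu (toc00 (x + y)) <= mubar mu (toc00 x) + mubar mu (toc00 y).
Proof.
have h1 := cvgD (@mubar_cvg_approx x) (@mubar_cvg_approx y).
have h2 : m (poly_approx n x + poly_approx n y) @[n --> \oo] --> mubar mu (toc00 (x + y)).
  apply: (@mubar_cvg (maxn (size x) (size y))) => [n|i].
    by rewrite (leq_trans (size_polyD _ _))// geq_max !leq_max !size_poly_approx orbT.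
  under eq_fun do rewrite coefD !coef_poly_approx rmorphD/=.
  by rewrite coefD; apply: cvgD; exact: rat_approx_cvg.
apply: (ler_cvg_to h2 (h1 _)); apply: nearW => n; exact: seminormV_D.
Qed.

Lemma mubarZ (a : R) (x : {poly R}) :
  mubar mu (toc00 (a *: x)) = `|a| * mubar mu (toc00 x).
Proof.
have h1 : m (rat_approx n a *: poly_approx n x) @[n --> \oo] --> `|a| * mubar mu (toc00 x).
  under eq_fun do rewrite seminormV_Z.
  apply: cvgM; last exact: mubar_cvg_approx.
  by apply: cvg_norm; exact: rat_approx_cvg.
apply: (@cvg_unique _ (@Rhausdorff R) _ _ _ _ _ h1).
apply: (@mubar_cvg (size x)) => [n|i].
  by rewrite (leq_trans (size_scale_leq _ _))// size_poly_approx.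
under eq_fun do rewrite coefZ coef_poly_approx rmorphM/=.
by rewrite coefZ; apply: cvgM; exact: rat_approx_cvg.
Qed.

Definition mubar_seminorm := Seminorm mubarZ mubarD.

Lemma completion_exists :
  exists (X : completeNormedModType R) (j : (nat -> R) -> X), is_completion mu j.
Proof.
(* [j] must be defined on all sequences; only its values on finitely supported ones matter. *)
have /choice[P PE] (x : nat -> R) :
    exists p : {poly R}, finsupp x -> x = (fun i => p`_i).
  by have [/finsupp_poly[p xp]|nx] := pselect (finsupp x); [exists p|exists 0].
exists (completion mubar_seminorm), (fun x => to_completion mubar_seminorm (P x)).
split; last split.
- move=> a x y xf yf; rewrite -linearP; congr to_completion; apply/polyP => i.
  have af : finsupp (fun i => a * x i + y i).
    have [[K xK] [L yL]] := (xf, yf); exists (maxn K L) => k.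
    by rewrite geq_max => /andP[/xK-> /yL->]; rewrite mulr0 addr0.
  have /(congr1 (@^~ i)) := PE _ af; rewrite coefD coefZ => <-.
  have /(congr1 (@^~ i)) := PE _ xf; have /(congr1 (@^~ i)) := PE _ yf.
  by move=> /= <- <-.
- move=> x; rewrite norm_to_completion/=; congr mubar; apply: sig_eq => /=.
  by rewrite -PE//; exact: (proj2_sig x).
- apply/seteqP; split => // x _ U /nbhs_ballP[e /= e0 eU].
  have [p xp] := to_completion_dense x (divr_gt0 e0 (ltr0n R 2)).
  exists (to_completion mubar_seminorm p); split.
    exists (fun i => p`_i); first exact: finsupp_polyseq.
    congr to_completion; apply/polyP => i.
    by have /(congr1 (@^~ i)) := PE _ (finsupp_polyseq p).
  apply: eU; rewrite -ball_normE/= (le_lt_trans xp)//.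
  by rewrite ltr_pdivrMr// ltr_pMr// ltr1n.
Qed.

End Rational_seminorm.

(** * Rational vectors inside a completion *)

Section Rational_embedding.
Variables (R : realType) (mu : V -> R) (X : completeNormedModType R).
Variable j : (nat -> R) -> X.
Hypotheses (muP : seminormV mu) (jP : is_completion mu j).
Implicit Types p q : {poly rat}.

Definition embed (p : {poly rat}) : X := j (fun i => ratr p`_i).

Lemma embedP a p q : embed (a *: p + q) = ratr a *: embed p + embed q.
Proof.
have f (r : {poly rat}) : finsupp (fun i => ratr r`_i : R).
  by have [N rN] := finsupp_polyseq r; exists N => i /rN/= ->; rewrite rmorph0.
rewrite /embed -jP.1//; congr j; apply/funext => i.
by rewrite coefD coefZ rmorphD rmorphM.
Qed.

Lemma norm_embed p : `|embed p| = mu (toV p).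
Proof.
rewrite -(mubar_rat muP) -jP.2.1/=; congr `|j _|; apply/funext => i /=.
by rewrite coef_map.
Qed.

(** The image of the real vectors is dense by definition; rounding the coefficients of [p] to order
    n then moves the image by at most M/(n+1). *)
Lemma embed_dense (x : X) (e : R) : 0 < e -> exists p, `|x - embed p| < e.
Proof.
move=> e0; have e2 : 0 < e / 2 by rewrite divr_gt0.
have : closure (j @` [set x | finsupp x]) x by rewrite jP.2.2.
move=> /(_ _ (nbhsx_ballx x _ e2))[_ [[y /finsupp_poly[p ->] <-]]].
rewrite -ball_normE/= => xy.
pose M := \sum_(i < size p) mubar_seminorm muP 'X^i.
have M0 : 0 <= M by apply: sumr_ge0 => i _; exact: seminorm_ge0.
near \oo => n; exists (poly_approx n p).
rewrite (le_lt_trans (ler_distD (j (fun i => p`_i)) _ _))// (splitr e) ltrD//.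
pose q : {poly R} := map_poly ratr (poly_approx n p).
have -> : embed (poly_approx n p) = j (fun i => q`_i).
  by congr j; apply/funext => i; rewrite coef_map.
have -> : j (fun i => p`_i) - j (fun i => q`_i) = j (fun i => (p - q)`_i).
  rewrite addrC -scaleN1r -jP.1; try exact: finsupp_polyseq.
  by congr j; apply/funext => i; rewrite coefB mulN1r addrC.
have -> : `|j (fun i => (p - q)`_i)| = mubar_seminorm muP (p - q).
  by rewrite /= -jP.2.1.
apply: (@le_lt_trans _ _ (n.+1%:R^-1 * M)); last first.
  rewrite mulrC ltr_pdivrMr// (mulrC (e / 2)) -ltr_pdivrMr//.
  apply: (@lt_trans _ _ n%:R); last by rewrite ltr_nat.
  by near: n; exact: nbhs_infty_gtr.
have -> : p - q = \sum_(i < size p) (p - q)`_i *: 'X^i.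
  rewrite -poly_def; apply/polyP => i; rewrite coef_poly; case: ltnP => // Ki.
  by rewrite coefB coef_map/= coef_poly_approx nth_default// /rat_approx mulr0
    floor0 mul0r rmorph0 subrr.
rewrite mulr_sumr; elim/big_rec2 : _ => [|i z r _ xy']; first by rewrite seminorm0.
rewrite (le_trans (seminormD _ _ _))// lerD// seminormZ ler_wpM2r ?seminorm_ge0//.
by rewrite coefB coef_map/= coef_poly_approx distrC rat_approxP.
Unshelve. all: by end_near. Qed.

(** The images of the monomials are independent: a vanishing combination has [mubar] equal to 0, so
    its coefficients vanish. *)
Lemma completion_infinite_dim :
  (forall x : c00 R, mubar mu x = 0 -> proj1_sig x = fun=> 0) -> infinite_dim X.
Proof.
move=> mu0 n; exists (fun i => j (fun k => ('X^i : {poly R})`_k)) => c.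
have jsum (I : Type) (s : seq I) (p : I -> {poly R}) (a : I -> R) :
    \sum_(i <- s) a i *: j (fun k => (p i)`_k) = j (fun k => (\sum_(i <- s) a i *: p i)`_k).
  elim: s => [|i s IH].
    rewrite !big_nil; apply/esym/eqP; rewrite -subr_eq0 oppr0 addr0.
    rewrite -normr_eq0 (jP.2.1 (toc00 0)).
    exact/eqP/(seminorm0 (mubar_seminorm muP)).
  rewrite !big_cons IH -jP.1; try exact: finsupp_polyseq.
  by congr j; apply/funext => k; rewrite coefD coefZ.
rewrite jsum => c0 i.
have /mu0/(congr1 (@^~ (i : nat))) : mubar mu (toc00 (\sum_(i < n) c i *: 'X^i)) = 0.
  by rewrite -jP.2.1/= c0 normr0.
rewrite /= coef_sum (bigD1 i)//= coefZ coefXn eqxx mulr1 big1 ?addr0// => k ki.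
by rewrite coefZ coefXn eq_sym (inj_eq val_inj) (negPf ki) mulr0.
Qed.

End Rational_embedding.

(** * The SD2P in terms of rational vectors *)

(** Both inequalities are strict, so a vector that satisfies them for a limit of pairs ([mu], [phi])
    satisfies them eventually along the way. *)
Definition rat_slice (R : realType) (mu : V -> R) (phi : {poly rat} -> R) (d : rat)
    (p : {poly rat}) :=
  mu (toV p) < 1 /\ 1 - 2 * ratr d < phi p.

(** Norm exactly 1 can be lost in a pointwise limit of functionals, whereas norm at least 1 - d at a
    fixed vector [v i] survives. The slice level 1 - 2d leaves room below that value. *)
Definition small_slices (R : realType) (mu : V -> R) (d : rat) (n : nat)
    (k : 'I_n.+1 -> nat) (v : 'I_n.+1 -> {poly rat})
    (phi : 'I_n.+1 -> {poly rat} -> R) :=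
  [/\ forall i a p q, phi i (a *: p + q) = ratr a * phi i p + phi i q,
      forall i p, `|phi i p| <= mu (toV p),
      forall i, mu (toV (v i)) <= 1 /\ 1 - ratr d <= phi i (v i) &
      forall x y, (forall i, rat_slice mu (phi i) d (x i)) ->
        (forall i, rat_slice mu (phi i) d (y i)) ->
        mu (toV (\sum_i (k i)%:R *: (x i - y i))) <=
          (2 - ratr d) * \sum_i (k i)%:R].

Definition has_small_slices (R : realType) (mu : V -> R) :=
  exists d n k v phi, [/\ 0 < d < 1, (0 < \sum_(i < n.+1) k i)%N &
    small_slices mu d k v phi].

(** * Functionals on the completion and on rational vectors *)

Section Functionals.
Variables (R : realType) (mu : V -> R) (X : completeNormedModType R).
Variable j : (nat -> R) -> X.
Hypotheses (muP : seminormV mu) (jP : is_completion mu j).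
Local Notation m p := (mu (toV p)).
Local Notation J := (embed j).
Implicit Types p q : {poly rat}.

Lemma embed0 : J 0 = 0.
Proof. by apply/eqP; rewrite -normr_eq0 (norm_embed muP jP) (seminormV_0 muP). Qed.

Lemma embedB p q : J (p - q) = J p - J q.
Proof. by rewrite addrC -scaleN1r (embedP jP) rmorphN1 scaleN1r addrC. Qed.

Lemma embed_sum n (a : 'I_n -> rat) (p : 'I_n -> {poly rat}) :
  J (\sum_i a i *: p i) = \sum_i ratr (a i) *: J (p i).
Proof.
by elim/big_ind2 : _ => [|? p1 ? p2 <- <-|i _]; rewrite ?embed0//;
  [rewrite -{1}(scale1r p1) (embedP jP) rmorph1 scale1r
  |rewrite -[X in J X]addr0 (embedP jP) embed0 addr0].
Qed.

(** Shrinking [x] by the factor 1 - d leaves room for a rational approximation of norm strictly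
    below 1; shrinking and approximating cost at most e/2 each. *)
Lemma embed_ball (x : X) (e : R) : `|x| <= 1 -> 0 < e ->
  exists p, m p < 1 /\ `|x - J p| < e.
Proof.
move=> x1 e0; pose d : R := Order.min 1 (e / 2).
have d0 : 0 < d by rewrite lt_min ltr01 divr_gt0.
have d1 : d <= 1 by rewrite ge_min lexx.
have de : d <= e / 2 by rewrite ge_min lexx orbT.
have [p xp] := embed_dense muP jP ((1 - d) *: x) d0; exists p.
have nx : `|(1 - d) *: x| <= 1 - d.
  by rewrite normrZ ger0_norm ?subr_ge0// ler_piMr// subr_ge0.
split.
  rewrite -(norm_embed muP jP) -[J p](subrK ((1 - d) *: x)).
  by rewrite (le_lt_trans (ler_normD _ _))//; move: xp; rewrite distrC; lra.
rewrite (le_lt_trans (ler_distD ((1 - d) *: x) _ _))//.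
have -> : x - (1 - d) *: x = d *: x by rewrite scalerBl scale1r subKr.
rewrite normrZ gtr0_norm//.
have : d * `|x| <= d by rewrite ler_piMr// ltW.
by move: xp; lra.
Qed.

(** A functional dominated by [mu] is 1-Lipschitz, and the supremum of [phi p - |x - J p|] extends
    it to [x] as a Lipschitz function. By density this value is a limit of values of [phi], from
    which linearity follows. *)
Lemma extend_functional (phi : {poly rat} -> R) :
  (forall a p q, phi (a *: p + q) = ratr a * phi p + phi q) ->
  (forall p, `|phi p| <= m p) ->
  exists f : X -> R, [/\ forall (a : R) x y, f (a *: x + y) = a * f x + f y,
    forall x, `|f x| <= `|x| & forall p, f (J p) = phi p].
Proof.
move=> phil phim.
have phiB p q : phi (p - q) = phi p - phi q.
  by rewrite addrC -scaleN1r phil rmorphN1 mulN1r addrC.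
have /choice[f fP] (x : X) : exists r, forall p, `|r - phi p| <= `|x - J p|.
  have ub p q : phi p - `|x - J p| <= phi q + `|x - J q|.
    have := phim (p - q); rewrite -(norm_embed muP jP) embedB phiB ler_norml => /andP[_].
    have := ler_distD x (J p) (J q); rewrite (distrC (J p) x); lra.
  have hs : has_sup [set phi p - `|x - J p| | p in [set: {poly rat}]].
    split; first by exists (phi 0 - `|x - J 0|); exists 0.
    by exists (phi 0 + `|x - J 0|) => _ [p _ <-]; exact: ub.
  exists (sup [set phi p - `|x - J p| | p in [set: {poly rat}]]) => q.
  rewrite ler_distl; apply/andP; split; first by apply: (ub_le_sup hs.2); exists q.
  by apply: ge_sup hs.1 _ => _ [p _ <-]; exact: ub.
have fJ p : f (J p) = phi p.
  by apply/eqP; rewrite -subr_eq0 -normr_le0 (le_trans (fP _ p))// subrr normr0.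
have phi0 : phi 0 = 0 by rewrite -[X in phi X](subrr 0) phiB subrr.
have fcvg x (p : nat -> {poly rat}) : J (p n) @[n --> \oo] --> x ->
    phi (p n) @[n --> \oo] --> f x.
  move=> /cvgrPdist_le px; apply/cvgrPdist_le => e /px.
  by apply: filterS => n; exact: le_trans (fP _ _).
have approx (x : X) : exists p : nat -> {poly rat}, J (p n) @[n --> \oo] --> x.
  have /choice[p pP] n : exists q, `|x - J q| < n.+1%:R^-1 :> R.
    by apply: (embed_dense muP jP); rewrite invr_gt0.
  exists p; apply/cvgrPdist_lt => e e0.
  have := near_infty_natSinv_lt (PosNum e0); apply: filterS => n.
  exact: lt_trans (pP n).
exists f; split => //; last first.
  by move=> x; have := fP x 0; rewrite phi0 embed0 !subr0.
move=> a x y; have [[p px] [q qy]] := (approx x, approx y).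
(* The real scalar [a] is approximated too, as [phi] is only linear over the rationals. *)
have h : phi (rat_approx n a *: p n + q n) @[n --> \oo] --> f (a *: x + y).
  apply: fcvg; under eq_fun do rewrite (embedP jP).
  by apply: cvgD => //; apply: cvgZ => //; exact: rat_approx_cvg.
have {h} := h; under eq_fun do rewrite phil; move=> h.
apply: (@cvg_unique _ (@Rhausdorff R) _ _ _ _ h).
by apply: cvgD; [apply: cvgM; [exact: rat_approx_cvg|exact: fcvg]|exact: fcvg].
Qed.

Section Linear_functional.
Variable f : X -> R.
Hypothesis fl : forall (a : R) x y, f (a *: x + y) = a * f x + f y.

Lemma functional0 : f 0 = 0.
Proof. by have := fl 1 0 0; rewrite scaler0 addr0 mul1r; lra. Qed.

Lemma functionalZ a x : f (a *: x) = a * f x.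
Proof. by rewrite -[a *: x]addr0 fl functional0 addr0. Qed.

Lemma functionalB x y : f (x - y) = f x - f y.
Proof. by rewrite addrC -scaleN1r fl mulN1r addrC. Qed.

Lemma functional_continuous : (forall x, `|f x| <= `|x|) -> continuous f.
Proof.
move=> fb x; apply/cvgrPdist_lt => e e0; near=> y.
rewrite -functionalB (le_lt_trans (fb _))//; near: y.
Unshelve. all: by end_near. Qed.

End Linear_functional.

(** [A] is the dual norm of [f], a supremum over the unit ball, hence squeezed between [f x0] and
    1. *)
Lemma dual_sphere_normalize (f : X -> R) (x0 : X) :
  (forall (a : R) x y, f (a *: x + y) = a * f x + f y) ->
  (forall x, `|f x| <= `|x|) -> `|x0| <= 1 -> 0 < f x0 ->
  exists A, [/\ f x0 <= A, A <= 1 & dual_sphere (fun x => A^-1 * f x)].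
Proof.
move=> fl fb x01 fx0; pose S := [set `|f x| | x in [set x : X | `|x| <= 1]].
have S1 : ubound S 1 by move=> _ [x /= x1 <-]; exact: le_trans (fb x) x1.
have Sx0 : S `|f x0| by exists x0.
have Ssup : has_sup S by split; [exists (`|f x0|)|exists 1].
have A0 : f x0 <= sup S by rewrite (le_trans (ler_norm _))// ub_le_sup//; exists 1.
have Sgt0 := lt_le_trans fx0 A0.
exists (sup S); split => //; first by apply: ge_sup Ssup.1 _.
split; first by move=> a x y; rewrite fl mulrDr mulrCA.
split; first by move=> x; apply: cvgMr; exact: functional_continuous.
pose T := [set `|(sup S)^-1 * f x| | x in [set x : X | `|x| <= 1]].
have T1 : ubound T 1.
  move=> _ [x /= x1 <-]; rewrite normrM gtr0_norm ?invr_gt0// ler_pdivrMl// mulr1.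
  by apply: ub_le_sup; [exists 1|exists x].
have Tsup : has_sup T by split; [exists `|(sup S)^-1 * f x0|; exists x0|exists 1].
rewrite -[X in ereal_sup X](image_comp _ EFin) (ereal_sup_EFin Tsup.2 Tsup.1).
congr EFin; apply/le_anti/andP; split; first by apply: ge_sup Tsup.1 _.
rewrite -(ler_pM2l Sgt0) mulr1; apply: ge_sup Ssup.1 _ => _ [x /= x1 <-].
have : `|(sup S)^-1 * f x| <= sup T by apply: ub_le_sup; [exists 1|exists x].
by rewrite normrM gtr0_norm ?invr_gt0// ler_pdivrMl.
Qed.

Lemma dual_sphere_le (f : X -> R) x : dual_sphere f -> `|f x| <= `|x|.
Proof.
move=> [fl [_ fs]]; have [->|x0] := eqVneq x 0; first by rewrite functional0// !normr0.
have nx : 0 < `|x| by rewrite normr_gt0.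
have : ((`|f (`|x|^-1 *: x)|)%:E <= 1)%E.
  rewrite -fs; apply: ereal_sup_ubound; exists (`|x|^-1 *: x) => //=.
  by rewrite normrZ normrV ?unitfE ?gt_eqF// normr_id mulVf// gt_eqF.
by rewrite lee_fin functionalZ// normrM normrV ?unitfE ?gt_eqF// normr_id
  ler_pdivrMl// mulr1.
Qed.

Lemma dual_sphere_witness (f : X -> R) (d : R) : dual_sphere f -> 0 < d ->
  exists p, m p < 1 /\ 1 - d < f (J p).
Proof.
move=> fS d0; have [fl [_ fs]] := fS.
have [_ [x /= x1 <-]] : exists2 y, [set (`|f x|)%:E | x in [set x : X | `|x| <= 1]] y &
    ((1 - d)%:E < y)%E.
  apply/ereal_sup_gtP; rewrite fs lte_fin; lra.
rewrite lte_fin => fx.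
(* The supremum controls only the absolute value; replacing [x] by [- x] fixes the sign. *)
wlog fx' : x x1 fx / 1 - d < f x.
  move=> h; have [fx0|fx0] := leP 0 (f x).
    by apply: (h x) => //; rewrite -(ger0_norm fx0).
  have fN : f (- x) = - f x by rewrite -scaleN1r functionalZ// mulN1r.
  by apply: (h (- x)); rewrite ?normrN// fN ?normrN// -(ltr0_norm fx0).
have e0 : 0 < f x - (1 - d) by rewrite subr_gt0.
have [p [p1 xp]] := embed_ball x1 e0; exists p; split => //.
have := dual_sphere_le (x - J p) fS.
by rewrite functionalB// ler_norml => /andP[_]; move: xp; lra.
Qed.

Lemma norm_sum_scale n (a : 'I_n -> R) (z : 'I_n -> X) (c : R) :
  (forall i, `|z i| <= c) -> `|\sum_i a i *: z i| <= (\sum_i `|a i|) * c.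
Proof.
move=> zc; rewrite (le_trans (ler_norm_sum _ _ _))// mulr_suml ler_sum// => i _.
by rewrite normrZ ler_wpM2l.
Qed.

End Functionals.

Lemma ratr_lt1 (R : realType) (d : rat) : (ratr d < 1 :> R) = (d < 1).
Proof. by rewrite -[1 in LHS](rmorph1 ratr) ltr_rat. Qed.

(** * Failure of the SD2P read off rational vectors *)

Section SD2P_criterion.
Variables (R : realType) (mu : V -> R) (X : completeNormedModType R).
Variable j : (nat -> R) -> X.
Hypotheses (muP : seminormV mu) (jP : is_completion mu j).
Local Notation m p := (mu (toV p)).
Local Notation J := (embed j).

(** The [phi i] extend to the completion and are divided by their norms. The SD2P then yields two
    points of the weighted slices more than 2 - D apart, and rational points close to them
    contradict smallness. *)
Lemma SD2P_no_small_slices : @SD2P R X -> ~ has_small_slices mu.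
Proof.
move=> sd [d [n [k [v [phi [/andP[d0 d1] k0 [phil phim vP small]]]]]]].
pose D : R := ratr d.
have D0 : 0 < D by rewrite -(rmorph0 ratr) ltr_rat.
have D1 : D < 1 by rewrite ratr_lt1.
have /choice[f /all_and3[fl fb fJ]] i := extend_functional muP jP (phil i) (phim i).
have /choice[A /all_and3[Av A1 AS]] i : exists A,
    [/\ 1 - D <= A, A <= 1 & dual_sphere (fun x => A^-1 * f i x)].
  have fv : 1 - D <= f i (J (v i)) by rewrite fJ; exact: (vP i).2.
  have [|//|A [fA A1 AS]] := @dual_sphere_normalize R X (f i) (J (v i)) (fl i) (fb i).
  - by rewrite (norm_embed muP jP); exact: (vP i).1.
  - by apply: lt_le_trans fv; rewrite subr_gt0.
  by exists A; split => //; exact: le_trans fA.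
have A0 i : 0 < A i by apply: lt_le_trans (Av i); rewrite subr_gt0.
pose K : R := \sum_i (k i)%:R.
have K0 : 0 < K by rewrite /K -natr_sum ltr0n.
(* Chosen so that the slice of the normalized functional is {f i > 1 - 2D}; it is positive because
   [A i] is at least 1 - D. *)
pose al i := 1 - (1 - 2 * D) / A i.
have al0 i : 0 < al i by rewrite subr_gt0 ltr_pdivrMr// mul1r; have := Av i; lra.
have lam0 i : 0 <= (k i)%:R / K by rewrite divr_ge0// ltW.
have lam1 : \sum_i (k i)%:R / K = 1 by rewrite -mulr_suml divff// gt_eqF.
have := sd n _ _ al lam0 lam1 AS al0; rewrite /diam => dm.
have [_ [_ [s [sS ->]] [_ [t [tS ->]] <-]]] :
    exists2 y, [set (`|x - y|)%:E | x in
        [set x | exists s, (forall i, slice (fun x => (A i)^-1 * f i x) (al i) (s i)) /\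
          x = \sum_i ((k i)%:R / K) *: s i] & y in
        [set x | exists s, (forall i, slice (fun x => (A i)^-1 * f i x) (al i) (s i)) /\
          x = \sum_i ((k i)%:R / K) *: s i]] y & ((2 - D)%:E < y)%E.
  by apply/ereal_sup_gtP; rewrite dm lte_fin; lra.
rewrite lte_fin -sumrB => gap.
have {}gap : 2 - D < `|\sum_i (k i)%:R / K *: (s i - t i)|.
  by apply: lt_le_trans gap _; rewrite le_eqVlt; apply/orP; left; apply/eqP;
    congr `|_|; apply: eq_bigr => i _; rewrite scalerBr.
set G := `|_| in gap.
(* An error of a quarter of the excess of [G] over 2 - D on each point moves the combination of
   differences by at most half of it. *)
have approx (u : 'I_n.+1 -> X) :
    (forall i, slice (fun x => (A i)^-1 * f i x) (al i) (u i)) ->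
    exists p : 'I_n.+1 -> {poly rat}, forall i,
      rat_slice mu (phi i) d (p i) /\ `|u i - J (p i)| <= (G - (2 - D)) / 4.
  move=> uS; suff /choice[p pP] : forall i, exists p, rat_slice mu (phi i) d p /\
    `|u i - J p| <= (G - (2 - D)) / 4 by exists p.
  move=> i.
  have [u1] := uS i; rewrite /al subKr mulrC ltr_pM2l ?invr_gt0// => fu.
  pose e := Order.min (f i (u i) - (1 - 2 * D)) ((G - (2 - D)) / 4).
  have e0 : 0 < e by rewrite lt_min subr_gt0 fu divr_gt0// subr_gt0.
  have [p [p1 up]] := embed_ball muP jP u1 e0; exists p.
  move: up; rewrite lt_min => /andP[up /ltW up']; split => //; split => //.
  have := fb i (u i - J p); rewrite (functionalB (fl i)) fJ ler_norml => /andP[_].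
  by move: up; rewrite -/D; lra.
have [p /all_and2[ps pt]] := approx _ sS.
have [q /all_and2[qs qt]] := approx _ tS.
have := small p q ps qs.
rewrite -(norm_embed muP jP) (embed_sum muP jP) -/D -/K.
have -> : \sum_i ratr (k i)%:R *: J (p i - q i) =
    K *: (\sum_i ((k i)%:R / K) *: (J (p i) - J (q i))).
  rewrite scaler_sumr; apply: eq_bigr => i _.
  by rewrite (embedB jP) scalerA mulrC divfK ?gt_eqF// ratr_nat.
rewrite normrZ gtr0_norm// mulrC ler_pM2r//.
set S := \sum_i _.
have : `|\sum_i (k i)%:R / K *: (s i - t i) - S| <= (G - (2 - D)) / 2.
  rewrite /S -sumrB; under eq_bigr do rewrite -scalerBr.
  apply: le_trans (@norm_sum_scale _ _ _ _ _ ((G - (2 - D)) / 2) _) _.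
    move=> i; rewrite [X in `|X|](_ : _ = (s i - J (p i)) - (t i - J (q i))); last first.
      by rewrite opprD addrACA -opprD.
    rewrite (le_trans (ler_normB _ _))//; have := pt i; have := qt i; lra.
  by under eq_bigr do rewrite ger0_norm//; rewrite lam1 mul1r.
have := ler_normD (\sum_i (k i)%:R / K *: (s i - t i) - S) S; rewrite subrK -/G; lra.
Qed.

(** If slices of norm-one functionals combine to a set of diameter at most r < 2, the same
    functionals restricted to rational vectors give small slices, once d is small and the weights
    [lam i] are replaced by integer parts of [N * lam i]. *)
Lemma SD2P_of_no_small_slices : ~ has_small_slices mu -> @SD2P R X.
Proof.
move=> ns n lam f al lam0 lam1 fS al0; rewrite /diam.
set C := [set x | _].
have lamN : \sum_i `|lam i| = 1 by under eq_bigr do rewrite ger0_norm//.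
have diam_le : (ereal_sup [set (`|x - y|)%:E | x in C & y in C] <= 2%:E)%E.
  apply: ge_ereal_sup => _ [_ [s [sS ->]] [_ [t [tS ->]] <-]].
  rewrite lee_fin -sumrB; under eq_bigr do rewrite -scalerBr.
  apply: le_trans (@norm_sum_scale _ _ _ _ _ 2 _) _; last by rewrite lamN mul1r.
  move=> i; rewrite (le_trans (ler_normB _ _))//.
  by have [[s1 _] [t1 _]] := (sS i, tS i); lra.
apply/eqP; rewrite eq_le diam_le leNgt; apply/negP => diam_lt.
have [r [r2 rC]] : exists r : R, r < 2 /\ forall x y, C x -> C y -> `|x - y| <= r.
  move: diam_lt; case E : (ereal_sup _) => [r| |] // r2.
    exists r; split; first by rewrite -lte_fin.
    move=> x y Cx Cy; rewrite -lee_fin -E; apply: ereal_sup_ubound.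
    by exists x => //; exists y.
  (* The supremum is [-oo], so no two points exist and any bound serves. *)
  exists 0; split => // x y Cx Cy; rewrite -lee_fin; apply: le_trans (leNye _).
  by rewrite -E; apply: ereal_sup_ubound; exists x => //; exists y.
(* For D < c, the level 1 - 2D lies above every 1 - [al i], D is below 1/2, and at most half of the
   gap 2 - r is lost to D. *)
pose c : R := Order.min (\big[Order.min/1]_i al i / 2) ((2 - r) / 2).
have c0 : 0 < c.
  rewrite lt_min !divr_gt0 ?subr_gt0 ?andbT//.
  by apply/bigmin_gtP; split => // i _.
have [d] := rat_in_itvoo c0; rewrite in_itv/= => /andP[].
set D : R := ratr d => D0 Dc.
have cal i : c <= al i / 2.
  by rewrite ge_min ler_pM2r ?invr_gt0// bigmin_le_cond.
have cr : c <= (2 - r) / 2 by rewrite ge_min lexx orbT.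
have c1 : c <= 1 / 2 by rewrite ge_min ler_pM2r ?invr_gt0// bigmin_le_id.
have /choice[v vP] i : exists p, m p < 1 /\ 1 - D < f i (J p).
  exact: dual_sphere_witness.
pose n1 : R := n.+1%:R; have n10 : 0 < n1 by rewrite ltr0n.
(* Rounding N lam to integers costs at most 2 n1 in the norm and n1 in the total weight. N(2 - r)/2
   >= 4 n1 absorbs both, and N >= n1 + 1 keeps the total weight positive. *)
pose N := 8 * n1 / (2 - r) + n1 + 1.
have N0 : n1 + 1 <= N by rewrite /N -addrA lerDr divr_ge0// ?subr_ge0 ?ltW// mulr_gt0.
have Nr : 4 * n1 <= N * ((2 - r) / 2).
  rewrite (_ : 4 * n1 = (8 * n1 / (2 - r)) * ((2 - r) / 2)); last first.
    by field; rewrite gt_eqF// subr_gt0.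
  apply: ler_wpM2r; first by rewrite divr_ge0// subr_ge0 ltW.
  rewrite /N; lra.
have Nlam i : 0 <= N * lam i by rewrite mulr_ge0//; lra.
pose k i := Num.truncn (N * lam i).
have kP i : `|(k i)%:R - N * lam i| <= 1.
  by rewrite ler_norml; have := truncn_itv (Nlam i); rewrite -natr1 => /andP[]; lra.
have Kge : N - n1 <= \sum_i (k i)%:R :> R.
  have -> : N - n1 = \sum_i (N * lam i - 1).
    by rewrite sumrB -mulr_sumr lam1 mulr1 sumr_const card_ord.
  by apply: ler_sum => i _; have := kP i; rewrite ler_norml; lra.
apply: ns; exists d, n, k, v, (fun i p => f i (J p)); split.
- rewrite -(ltr_rat R) rmorph0 -/D D0 -(ratr_lt1 R) -/D/=; lra.
- rewrite -(ltr0n R) natr_sum; apply: lt_le_trans Kge; lra.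
split.
- by move=> i a p q; rewrite (embedP jP) (fS i).1.
- by move=> i p; rewrite -(norm_embed muP jP); exact: dual_sphere_le (fS i).
- by move=> i; have [/ltW ? /ltW] := vP i.
move=> x y xS yS.
have slJ i p : rat_slice mu (fun p => f i (J p)) d p -> slice (f i) (al i) (J p).
  move=> [p1 fp]; split; first by rewrite (norm_embed muP jP) ltW.
  by move: fp; rewrite -/D; have := cal i; lra.
pose z i := J (x i) - J (y i).
have zr : `|\sum_i lam i *: z i| <= r.
  under eq_bigr do rewrite scalerBr; rewrite sumrB; apply: rC.
    by exists (fun i => J (x i)); split => // i; exact: slJ.
  by exists (fun i => J (y i)); split => // i; exact: slJ.
have z2 i : `|z i| <= 2.
  rewrite (le_trans (ler_normB _ _))// !(norm_embed muP jP).
  by have [[x1 _] [y1 _]] := (xS i, yS i); lra.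
rewrite -(norm_embed muP jP) (embed_sum muP jP).
have -> : \sum_i ratr (k i)%:R *: J (x i - y i) =
    N *: (\sum_i lam i *: z i) + \sum_i ((k i)%:R - N * lam i) *: z i.
  rewrite scaler_sumr -big_split/=; apply: eq_bigr => i _.
  by rewrite (embedB jP) scalerA -scalerDl subrKC ratr_nat.
have NN : 0 <= N by lra.
have h1 : `|N *: \sum_i lam i *: z i| <= N * r by rewrite normrZ ger0_norm// ler_wpM2l.
have h2 : `|\sum_i ((k i)%:R - N * lam i) *: z i| <= n1 * 2.
  apply: le_trans (norm_sum_scale _ z2) _; rewrite ler_pM2r//.
  have -> : n1 = \sum_(i < n.+1) 1 by rewrite sumr_const card_ord.
  exact: ler_sum.
rewrite (le_trans (ler_normD _ _))//.
apply: (@le_trans _ _ ((2 - D) * (N - n1))); last by rewrite ler_wpM2l// -/D; lra.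
apply: (@le_trans _ _ (N * r + n1 * 2)); first exact: lerD.
have : N * D <= N * ((2 - r) / 2) by rewrite ler_wpM2l//; lra.
have : 0 <= D * n1 by rewrite mulr_ge0// ltW.
by move: Nr; rewrite (_ : (2 - D) * (N - n1) = 2 * N - 2 * n1 - N * D + D * n1);
  [|ring]; lra.
Qed.

End SD2P_criterion.

(** One direction applies to whichever completion witnesses the SD2P; the other uses the completion
    constructed above. *)
Lemma SD2PsetP (R : realType) (mu : V -> R) : seminormV mu ->
  SD2Pset R mu <-> ~ has_small_slices mu.
Proof.
move=> muP; split => [[X [j [jP sd]]]|ns]; first exact: SD2P_no_small_slices jP sd.
have [X [j jP]] := completion_exists muP; exists X, j; split => //.
exact: SD2P_of_no_small_slices jP ns.
Qed.

(** * Closedness *)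

HB.instance Definition _ := gen_eqMixin V.
HB.instance Definition _ := gen_choiceMixin V.

Lemma ultra_fmap (T U : Type) (f : T -> U) (F : set_system T) :
  UltraFilter F -> UltraFilter (f @ F).
Proof.
move=> FU; split; first exact: fmap_proper_filter.
move=> G GP FG; apply/seteqP; split => // A GA.
have [//|FnA] := in_ultra_setVsetC (f @^-1` A) FU.
by have [x []] := filter_ex (filterI GA (FG (~` A) FnA)).
Qed.

Lemma ultra_bounded_cvg (R : realType) (T : Type) (F : set_system T) (f : T -> R) (b : R) :
  UltraFilter F -> (\forall x \near F, `|f x| <= b) -> exists l : R, f @ F --> l.
Proof.
move=> FU fb; have fFU := ultra_fmap f FU.
have := @segment_compact R (- b) b; rewrite compact_ultra => /(_ _ fFU)[|l []].
  by apply: filterS fb => x; rewrite /= in_itv/= ler_norml.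
by exists l.
Qed.

(* Functionals dominated by a convergent family of seminorms are pointwise bounded,
   so they converge along an ultrafilter. *)
Lemma small_slices_closed (R : realType) (d : rat) (n : nat) (k : 'I_n.+1 -> nat)
    (v : 'I_n.+1 -> {poly rat}) :
  closed [set mu : RV R | exists phi, small_slices mu d k v phi].
Proof.
set A := [set mu | _]; move=> mu0; rewrite closureEcvg => -[G GP [Gmu AG]].
(* Along an ultrafilter all the values [phi mu i p] converge at once, without extracting subnets. *)
have [F [FU GF]] := ultraFilterLemma GP.
have FA : F A by apply: GF; apply: AG.
have Fmu p : mu (toV p) @[mu --> F] --> mu0 (toV p).
  apply: cvg_trans (@proj_continuous V (fun=> R) (toV p) mu0).
  by apply: cvg_app; exact: subset_trans GF.
have [phi phiP] : exists phi : RV R -> 'I_n.+1 -> {poly rat} -> R,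
    forall mu, A mu -> small_slices mu d k v (phi mu).
  suff /choice[phi phiP] (mu : RV R) : exists phi, A mu -> small_slices mu d k v phi.
    by exists phi.
  by have [[phi ?]|nA] := pselect (A mu); [exists phi|exists (fun _ _ => 0)].
have /choice[psi Fphi] (ip : 'I_n.+1 * {poly rat}) :
    exists l : R, phi mu ip.1 ip.2 @[mu --> F] --> l.
  case: ip => i p; apply: (@ultra_bounded_cvg _ _ _ _ (mu0 (toV p) + 1)) => //.
  have Fp : \forall mu \near F, mu (toV p) < mu0 (toV p) + 1.
    by apply: (cvgr_lt _ (Fmu p)); rewrite ltrDl.
  apply: filterS2 FA Fp => mu /phiP[_ phim _ _] /ltW; exact: le_trans.
have {}Fphi i p : phi mu i p @[mu --> F] --> psi (i, p) := Fphi (i, p).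
exists (fun i p => psi (i, p)); split.
- move=> i a p q.
  have h : ratr a * phi mu i p + phi mu i q @[mu --> F] -->
      ratr a * psi (i, p) + psi (i, q) by apply: cvgD => //; exact: cvgMr.
  have e : \forall mu \near F, phi mu i (a *: p + q) = ratr a * phi mu i p + phi mu i q.
    by apply: filterS FA => mu /phiP[phil _ _ _].
  apply/le_anti/andP; split.
    by apply: (ler_cvg_to (Fphi _ _) h); apply: filterS e => mu ->.
  by apply: (ler_cvg_to h (Fphi _ _)); apply: filterS e => mu ->.
- move=> i p; apply: (ler_cvg_to (cvg_norm (Fphi i p)) (Fmu p)).
  by apply: filterS FA => mu /phiP[].
- move=> i; split.
    apply: (ler_cvg_to (Fmu _) (cvg_cst (1 : R))).
    by apply: filterS FA => mu /phiP[_ _ /(_ i)[]].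
  apply: (ler_cvg_to (cvg_cst (1 - ratr d : R)) (Fphi _ _)).
  by apply: filterS FA => mu /phiP[_ _ /(_ i)[]].
- move=> x y xS yS.
  apply: (ler_cvg_to (Fmu _) (cvg_cst ((2 - ratr d) * \sum_i (k i)%:R : R))).
  (* Vectors in the limit slices lie in the slices for F-almost all [mu], where the norm bound is
     available. *)
  have slices z : (forall i, rat_slice mu0 (fun p => psi (i, p)) d (z i)) ->
      \forall mu \near F, forall i, rat_slice mu (phi mu i) d (z i).
    move=> zS; apply: filter_forall => i; have [z1 zd] := zS i.
    have h1 : \forall mu \near F, mu (toV (z i)) < 1 by exact: (cvgr_lt _ (Fmu _)).
    have h2 : \forall mu \near F, 1 - 2 * ratr d < phi mu i (z i).
      exact: (cvgr_gt _ (Fphi _ _)).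
    by apply: filterS2 h1 h2 => mu.
  by apply: filterS3 FA (slices _ xS) (slices _ yS) => mu /phiP[_ _ _]; apply.
Qed.

(** Finite functions make the parameters (n, k, v, d) a countable type, so the set is a countable
    intersection of complements of closed sets. *)
Lemma no_small_slices_Gdelta (R : realType) :
  Gdelta [set mu : RV R | ~ has_small_slices mu].
Proof.
pose T : countType := ({n : nat & ({ffun 'I_n.+1 -> nat} *
  {ffun 'I_n.+1 -> {poly rat}})%type} * rat)%type.
pose S (t : T) : set (RV R) := [set mu | exists phi,
  small_slices mu t.2 (tagged t.1).1 (tagged t.1).2 phi].
pose good (t : T) := (0 < t.2 < 1) && (0 < \sum_i (tagged t.1).1 i)%N.
(* Codes of no parameter, or of an inadmissible one, impose no condition. *)
exists (fun m => if unpickle m is Some t then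
  if good t then ~` S t else setT else setT).
  move=> m; case: unpickle => [t|]; last exact: openT.
  case: ifP => _; last exact: openT.
  by apply: closed_openC; exact: small_slices_closed.
apply/seteqP; split => [mu nb m _|mu muG [d [n [k [v [phi [d01 k0 small]]]]]]].
  case: unpickle => [t|] //; case: ifP => // /andP[d01 k0] [phi small]; apply: nb.
  by exists t.2, (tag t.1), (tagged t.1).1, (tagged t.1).2, phi.
pose t : T := (Tagged (fun n => ({ffun 'I_n.+1 -> nat} *
  {ffun 'I_n.+1 -> {poly rat}})%type) ([ffun i => k i], [ffun i => v i]), d).
have := muG (pickle t) I; rewrite pickleK /good/= d01/=.
under eq_bigr do rewrite ffunE; rewrite k0; apply; exists phi.
have kE : ([ffun i => k i] : 'I_n.+1 -> nat) = k by apply/funext => i; rewrite ffunE.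
have vE : ([ffun i => v i] : 'I_n.+1 -> {poly rat}) = v by apply/funext => i; rewrite ffunE.
by move: small; rewrite -{1}kE -{1}vE.
Qed.

(** * Block norms *)

Section Block_norm.
Variables (R : realType) (t : nat -> nat).
Implicit Types p q : {poly rat}.

Definition block b p : R := \sum_(i < size p | t i == b) `|ratr p`_i|.

(** The supremum over all blocks, indexed by coordinates of [p] so as to stay finite even when [t]
    is unbounded. *)
Definition block_norm p : R := \big[Order.max/0]_(k < size p) block (t k) p.

Lemma blockE K b p : (size p <= K)%N ->
  block b p = \sum_(i < K | t i == b) `|ratr p`_i|.
Proof.
move=> pK; rewrite /block (big_ord_widen_cond K (fun i => t i == b)
  (fun i => `|ratr p`_i|))// big_mkcondr/=; apply: eq_bigr => i _.
by case: ltnP => // pi; rewrite nth_default// rmorph0 normr0.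
Qed.

Lemma block_ge0 b p : 0 <= block b p.
Proof. exact: sumr_ge0. Qed.

Lemma blockD b p q : block b (p + q) <= block b p + block b q.
Proof.
pose K := maxn (size p) (size q).
rewrite !(@blockE K) ?leq_maxl ?leq_maxr ?size_polyD// -big_split/=.
by apply: ler_sum => i _; rewrite coefD rmorphD ler_normD.
Qed.

Lemma blockZ b a p : block b (a *: p) = `|ratr a| * block b p.
Proof.
rewrite !(@blockE (size p)) ?size_scale_leq// mulr_sumr.
by apply: eq_bigr => i _; rewrite coefZ rmorphM normrM.
Qed.

Lemma block_sum I (r : seq I) (p : I -> {poly rat}) b :
  block b (\sum_(i <- r) p i) <= \sum_(i <- r) block b (p i).
Proof.
elim/big_rec2: _ => [|i q x _]; first by rewrite /block size_poly0 big_ord0.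
by move=> h; rewrite (le_trans (blockD _ _ _))// lerD2l.
Qed.

Lemma blockXn b i : block b 'X^i = (t i == b)%:R.
Proof.
rewrite /block size_polyXn big_mkcond big_ord_recr/= big1 ?add0r.
  by rewrite coefXn eqxx rmorph1 normr1; case: eqP.
by move=> j _; rewrite coefXn (ltn_eqF (ltn_ord j)) rmorph0 normr0 if_same.
Qed.

Lemma coef_le_block i p : `|ratr p`_i| <= block (t i) p.
Proof.
have [ip|pi] := ltnP i (size p); last by rewrite nth_default// rmorph0 normr0 block_ge0.
by rewrite /block (bigD1 (Ordinal ip))//= lerDl sumr_ge0.
Qed.

Lemma block_le_norm b p : block b p <= block_norm p.
Proof.
have [[i /eqP <-]|nb] := pselect (exists i : 'I_(size p), t i == b).
  by rewrite /block_norm; apply: (le_bigmax _ (fun k : 'I_(size p) => block (t k) p)).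
rewrite [X in X <= _]big1 => [|i ti]; last by case: nb; exists i.
exact: bigmax_ge_id.
Qed.

Lemma block_norm_le p c : 0 <= c -> (forall b, block b p <= c) -> block_norm p <= c.
Proof. by move=> c0 pc; apply: bigmax_le. Qed.

Lemma block_norm_ge0 p : 0 <= block_norm p.
Proof. exact: bigmax_ge_id. Qed.

Lemma coef_le_block_norm i p : `|ratr p`_i| <= block_norm p.
Proof. exact: le_trans (coef_le_block _ _) (block_le_norm _ _). Qed.

Lemma block_normD p q : block_norm (p + q) <= block_norm p + block_norm q.
Proof.
apply: block_norm_le => [|b]; first by rewrite addr_ge0// block_norm_ge0.
by rewrite (le_trans (blockD _ _ _))// lerD// block_le_norm.
Qed.

Lemma block_normZ a p : block_norm (a *: p) = `|ratr a| * block_norm p.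
Proof.
(* The reverse inequality comes from this one for the inverse of [a] and the vector [a *: p]. *)
have le c q : block_norm (c *: q) <= `|ratr c| * block_norm q.
  apply: block_norm_le => [|b]; first by rewrite mulr_ge0// block_norm_ge0.
  by rewrite blockZ ler_wpM2l// block_le_norm.
apply/le_anti; rewrite le/=; have [->|a0] := eqVneq a 0.
  by rewrite rmorph0 normr0 mul0r block_norm_ge0.
have ra : ratr a != 0 :> R by rewrite fmorph_eq0.
rewrite -ler_pdivlMl ?normr_gt0// -normfV -fmorphV.
by rewrite (le_trans _ (le _ _))// scalerA mulVf// scale1r.
Qed.

End Block_norm.

Definition toP (v : V) : {poly rat} := projT1 (cid (toV_surj v)).

Lemma toPK (v : V) : toV (toP v) = v.
Proof. by rewrite /toP; case: cid. Qed.

Lemma toVK (p : {poly rat}) : toP (toV p) = p.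
Proof.
apply/polyP => i; have := congr1 (fun v : V => proj1_sig v i) (toPK (toV p)).
by [].
Qed.

Definition block_seminorm (R : realType) (t : nat -> nat) (v : V) : R :=
  block_norm R t (toP v).

Section Block_seminorm.
Variables (R : realType) (t : nat -> nat).
Local Notation mu := (block_seminorm R t).
Implicit Types p q : {poly rat}.

Lemma block_seminormE p : mu (toV p) = block_norm R t p.
Proof. by rewrite /block_seminorm toVK. Qed.

Lemma block_seminormP : seminormV mu.
Proof.
split=> [u v w|q u v].
  rewrite -(toPK u) -(toPK v) -(toPK w) !block_seminormE => e.
  have -> : toP u = toP v + toP w.
    by apply/polyP => i; have /= := congr1 (@^~ i) e; rewrite coefD.
  exact: block_normD.
rewrite -(toPK u) -(toPK v) !block_seminormE => e.
have -> : toP u = q *: toP v.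
  by apply/polyP => i; have /= := congr1 (@^~ i) e; rewrite coefZ.
by rewrite block_normZ ratr_norm.
Qed.

(** Each coefficient is bounded by the block norm, and this bound passes to the limit of the
    rational approximations. *)
Lemma mubar_block_seminorm_eq0 (x : c00 R) : mubar mu x = 0 -> proj1_sig x = fun=> 0.
Proof.
have [p ->] := toc00_surj x => mup; apply/funext => i /=.
have h := @mubar_cvg_approx _ _ block_seminormP p; rewrite mup in h.
have hi : `|ratr (poly_approx n p)`_i| @[n --> \oo] --> `|p`_i|.
  under eq_fun do rewrite coef_poly_approx.
  by apply: cvg_norm; exact: rat_approx_cvg.
apply/eqP; rewrite -normr_le0; apply: (ler_cvg_to hi h); apply: nearW => n.
by rewrite block_seminormE; exact: coef_le_block_norm.
Qed.

Lemma block_seminorm_Bset : Bset R mu.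
Proof.
split; last exact: mubar_block_seminorm_eq0.
split; first exact: block_seminormP.
have [X [j jP]] := completion_exists block_seminormP; exists X, j; split => //.
exact: completion_infinite_dim block_seminormP jP mubar_block_seminorm_eq0.
Qed.

Lemma sum_indic_le1 (n : nat) (P : pred 'I_n) :
  (forall i j, P i -> P j -> i = j) -> \sum_i (P i)%:R <= 1 :> R.
Proof.
move=> Pu; have [[i Pi]|nP] := pselect (exists i, P i).
  rewrite (bigD1 i)//= Pi big1 ?addr0// => k ki.
  by case: (boolP (P k)) => // Pk; rewrite (Pu _ _ Pk Pi) eqxx in ki.
by rewrite big1// => i _; case: (boolP (P i)) => // Pi; case: nP; exists i.
Qed.

Lemma functional_sum (phi : {poly rat} -> R) I (r : seq I) (a : I -> rat)
    (p : I -> {poly rat}) :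
  (forall a p q, phi (a *: p + q) = ratr a * phi p + phi q) ->
  phi (\sum_(i <- r) a i *: p i) = \sum_(i <- r) ratr (a i) * phi (p i).
Proof.
move=> phil; have phi0 : phi 0 = 0.
  by have := phil 1 0 0; rewrite scaler0 addr0 rmorph1 mul1r; lra.
by elim: r => [|i r IH]; rewrite ?(big_nil, big_cons)// phil IH.
Qed.

(** Beyond the blocks met by the [v i], unit vectors [u j] in distinct blocks behave like the basis
    of c_0, so each [phi i] is summable on them and some [u j] is almost killed by all [phi i]. The
    vectors [v i + u j] and [v i - u j], slightly shrunk, then lie in the slices, and their
    differences are all the same multiple of [u j]. *)
Lemma unbounded_no_small_slices :
  (forall B, exists i, (B <= t i)%N) -> ~ has_small_slices mu.
Proof.
move=> /choice[h hP] [d [n [k [v [phi [/andP[d0 d1] k0 [phil phim vP small]]]]]]].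
pose D : R := ratr d.
have D0 : 0 < D by rewrite -(rmorph0 ratr) ltr_rat.
have D1 : D < 1 by rewrite ratr_lt1.
pose L := \max_i size (v i); pose b0 := \max_(i < L) t i.
have vL i : (size (v i) <= L)%N by exact: leq_bigmax.
have tL i : (i < L)%N -> (t i <= b0)%N.
  by move=> iL; exact: (leq_bigmax (F := fun i : 'I_L => t i) (Ordinal iL)).
(* Coordinates in strictly increasing blocks, all beyond [b0]. *)
have [idx [idx_b0 idxS]] : exists idx : nat -> nat,
    (forall j, b0 < t (idx j))%N /\ forall j, (t (idx j) < t (idx j.+1))%N.
  pose fix idx j := h (if j is j'.+1 then maxn b0 (t (idx j')) else b0).+1.
  exists idx; split => [[|j]|j]; first exact: hP.
    by apply: leq_trans (hP _); rewrite ltnS leq_maxl.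
  by apply: leq_trans (hP _); rewrite ltnS leq_maxr.
have idx_mono i j : (i < j)%N -> (t (idx i) < t (idx j))%N.
  exact: (homo_ltn ltn_trans idxS).
have idx_inj i j : t (idx i) = t (idx j) -> i = j.
  by case: (ltngtP i j) => // /idx_mono + e; rewrite e ltnn.
pose u j : {poly rat} := 'X^(idx j).
have phi_u M i : \sum_(j < M) `|phi i (u j)| <= 1.
  (* With these signs the sum is the value of [phi i] at a vector having at most one entry, of
     modulus 1, in each block. *)
  pose s (j : 'I_M) : rat := if 0 <= phi i (u j) then 1 else -1.
  have -> : \sum_(j < M) `|phi i (u j)| = phi i (\sum_j s j *: u j).
    rewrite functional_sum//; apply: eq_bigr => j _; rewrite /s.
    case: leP => [p0|/ltW p0]; first by rewrite rmorph1 mul1r ger0_norm.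
    by rewrite rmorphN1 mulN1r ler0_norm.
  rewrite (le_trans (ler_norm _))// (le_trans (phim _ _))// block_seminormE.
  apply: block_norm_le => // b; rewrite (le_trans (block_sum _ _ _ _ _))//.
  apply: (@le_trans _ _ (\sum_(j < M) (t (idx j) == b)%:R)).
    apply: ler_sum => j _; rewrite blockZ blockXn /s; case: ifP => _.
      by rewrite rmorph1 normr1 mul1r.
    by rewrite rmorphN1 normrN1 mul1r.
  apply: sum_indic_le1 => i' j' /eqP ei /eqP ej; apply/val_inj/idx_inj.
  by rewrite ei ej.
have [j uj] : exists j, \sum_i `|phi i (u j)| < D / 4.
  (* If every [u j] had total at least D/4, then M of them would exceed the bound n + 1 obtained by
     exchanging the sums. *)
  pose M := (Num.bound (n.+1%:R * 4 / D)).
  have MD : n.+1%:R < M%:R * (D / 4) :> R.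
    have : n.+1%:R * 4 / D < M%:R by apply: archi_boundP; rewrite divr_ge0// ltW.
    by rewrite ltr_pdivrMr// mulrA ltr_pdivlMr.
  apply: contrapT => /forallNP nj.
  have : M%:R * (D / 4) <= \sum_(j < M) \sum_i `|phi i (u j)|.
    rewrite mulr_natl -[in X in X <= _](card_ord M) -sumr_const; apply: ler_sum => j _.
    by rewrite leNgt; apply/negP; exact: nj.
  rewrite exchange_big/= leNgt => /negP; apply; apply: le_lt_trans MD.
  rewrite -[n.+1 in leRHS]card_ord -sumr_const; apply: ler_sum => i _; exact: phi_u.
(* Shrinking by [th] makes the norms strictly less than 1, keeps the values at least (1 - D/4)(1 -
   5D/4) > 1 - 2D, and leaves 2 T = 2 - D/2 > 2 - D. *)
pose th : rat := 1 - d / 4; pose T : R := ratr th.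
have TE : T = 1 - D / 4 by rewrite /T rmorphB rmorph1 fmorph_div/= ratr_nat.
have vu i (s : rat) : `|s| = 1 -> mu (toV (v i + s *: u j)) <= 1.
  move=> s1; rewrite block_seminormE; apply: block_norm_le => // b.
  have rs : `|ratr s| = 1 :> R by rewrite -ratr_norm s1 rmorph1.
  rewrite (le_trans (blockD _ _ _ _ _))// blockZ rs mul1r blockXn.
  have [bE|_] := eqVneq (t (idx j)) b.
    rewrite [X in X + _]big1 ?add0r// => l /eqP tl.
    have := tL l (leq_trans (ltn_ord l) (vL i)); rewrite tl -bE leqNgt.
    by rewrite idx_b0.
  rewrite addr0 (le_trans (block_le_norm _ _ _ _))// -block_seminormE.
  exact: (vP i).1.
have slice_vu i (s : rat) : `|s| = 1 ->
    rat_slice mu (phi i) d (th *: (v i + s *: u j)).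
  move=> s1; rewrite /rat_slice (seminormV_Z block_seminormP) -/T ger0_norm; last first.
    by rewrite TE; lra.
  split.
    apply: (@le_lt_trans _ _ (T * 1)); last by rewrite mulr1 TE; lra.
    by rewrite ler_wpM2l ?vu// TE; lra.
  have -> : phi i (th *: (v i + s *: u j)) = T * (phi i (v i) + ratr s * phi i (u j)).
    have phi0 : phi i 0 = 0.
      by have := phil i 1 0 0; rewrite scaler0 addr0 rmorph1 mul1r; lra.
    rewrite -[X in phi i X]addr0 phil phi0 addr0; congr (_ * _).
    by rewrite addrC phil addrC.
  have h1 : 1 - D <= phi i (v i) := (vP i).2.
  have h2 : - (D / 4) < ratr s * phi i (u j).
    have : `|ratr s * phi i (u j)| < D / 4.
      rewrite normrM -ratr_norm s1 rmorph1 mul1r; apply: le_lt_trans uj.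
      by rewrite (bigD1 i)//= lerDl sumr_ge0.
    by rewrite ltr_norml => /andP[].
  apply: (@lt_le_trans _ _ (T * (1 - D - D / 4))).
    by rewrite TE -/D; nra.
  by rewrite ler_wpM2l ?TE; lra.
have := small _ _ (fun i => slice_vu i 1 (normr1 _)) (fun i => slice_vu i (-1) (normrN1 _)).
have K0 : 0 < \sum_i (k i)%:R :> R by rewrite -natr_sum ltr0n.
have -> : \sum_i (k i)%:R *: (th *: (v i + 1 *: u j) - th *: (v i + (-1) *: u j)) =
    (th * 2 * \sum_i (k i)%:R) *: u j.
  rewrite mulr_sumr scaler_suml; apply: eq_bigr => i _.
  rewrite -scalerBr opprD addrACA subrr add0r scale1r scaleN1r opprK -mulr2n.
  by rewrite -scaler_nat !scalerA; congr (_ *: _); ring.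
rewrite (seminormV_Z block_seminormP) block_seminormE.
apply/negP; rewrite -ltNge !rmorphM/= rmorph_sum/= -/T.
under [in ltRHS]eq_bigr do rewrite ratr_nat.
have T0 : 0 < T by rewrite TE; lra.
have TK0 : 0 <= T * 2 * \sum_i (k i)%:R.
  by apply: mulr_ge0 (ltW K0); apply: mulr_ge0 (ltW T0) _.
rewrite ratr_nat ger0_norm; last exact: TK0.
apply: (@lt_le_trans _ _ (T * 2 * \sum_i (k i)%:R)).
  by rewrite ltr_pM2r// TE -/D; lra.
apply: ler_peMr TK0 _.
by have := block_le_norm R t (t (idx j)) (u j); rewrite blockXn eqxx.
Qed.

End Block_seminorm.

Section Bounded_blocks.
Variables (R : realType) (t : nat -> nat).
Local Notation mu := (block_seminorm R t).
Implicit Types p q : {poly rat}.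

(* With one coordinate [rep i] chosen in each of the [c] blocks, averaging the
   chosen coordinates gives a functional whose narrow slices force every chosen
   coordinate to be at least [d = 1 / (2 c + 1)], so that no block of a
   difference of two slice elements reaches norm 2. *)
Lemma bounded_small_slices : (exists B, forall i, (t i < B)%N) -> has_small_slices mu.
Proof.
(* The default 0 is never the value of [rep] by default, since the block [t i] contains [i]; it only
   serves [r0] on empty blocks. *)
move=> [B tB]; pose r0 b := xget 0%N [set i | t i = b]; pose rep i := r0 (t i).
have t_rep i : t (rep i) = t i.
  by rewrite /rep /r0; apply: (@xgetPex _ 0%N [set k | t k = t i]); exists i.
have rep_rep i : rep (rep i) = rep i by rewrite {1}/rep t_rep.
have rep_eq i k : rep i = i -> t i = t k -> i = rep k.
  by move=> <-; rewrite t_rep /rep => ->.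
pose K := (\max_(b < B) r0 b).+1.
have rep_lt i : (rep i < K)%N.
  by rewrite ltnS (leq_bigmax (F := fun b : 'I_B => r0 b) (Ordinal (tB i))).
pose c := #|[pred i : 'I_K | rep i == i]|.
have c0 : (0 < c)%N.
  by apply/card_gt0P; exists (Ordinal (rep_lt 0%N)); rewrite inE/= rep_rep.
have cR : 0 < c%:R :> R by rewrite ltr0n.
have sum_c : \sum_(i < K | rep i == i) 1 = c%:R :> R by rewrite sumr_const.
pose phi p : R := (\sum_(i < K | rep i == i) ratr p`_i) / c%:R.
pose v : {poly rat} := \poly_(i < K) (rep i == i)%:R.
(* Solves (1 - 2d) c = c - 1 + d: if c numbers at most 1 have a sum above the left side, each of
   them exceeds d. *)
pose d : rat := (2 * c + 1)%:R^-1.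
have d0 : 0 < d by rewrite invr_gt0 ltr0n addn1.
have dE : ratr d = (2 * c%:R + 1)^-1 :> R by rewrite /d fmorphV/= rmorph_nat natrD natrM.
have d1 : d < 1 by rewrite invf_lt1 ?ltr1n ?ltr0n ?addn1// ltnS muln_gt0.
exists d, 0%N, (fun=> 1%N), (fun=> v), (fun=> phi); split; first by rewrite d0.
  by rewrite big_ord1.
split=> [_ a p q|_ p|_|x y xS yS].
- rewrite /phi mulrA -mulrDl mulr_sumr -big_split/=; congr (_ / _).
  by apply: eq_bigr => i _; rewrite coefD coefZ rmorphD rmorphM.
- rewrite normrM [`|c%:R^-1|]gtr0_norm ?invr_gt0//.
  rewrite ler_pdivrMr// (le_trans (ler_norm_sum _ _ _))// mulrC -sum_c mulr_suml.
  by apply: ler_sum => i _; rewrite mul1r block_seminormE coef_le_block_norm.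
- split.
    rewrite block_seminormE; apply: block_norm_le => // b.
    rewrite (@blockE _ _ K) ?size_poly// big_mkcond/=.
    apply: (@le_trans _ _ (\sum_(i < K) ((t i == b) && (rep i == i))%:R)).
      apply: ler_sum => i _; case: (t i == b) => //=.
      by rewrite coef_poly ltn_ord; case: eqP; rewrite ?(rmorph1, normr1, rmorph0, normr0).
    apply: sum_indic_le1 => i k /andP[/eqP ti /eqP ri] /andP[/eqP tk /eqP rk].
    by apply/val_inj; rewrite /= (rep_eq i k ri) ?ti ?tk.
  rewrite /phi (eq_bigr (fun=> 1)); first rewrite sum_c divff ?gt_eqF//.
    by rewrite lerBlDr lerDl dE invr_ge0 addr_ge0// mulr_ge0// ltW.
  by move=> i ri; rewrite coef_poly ltn_ord ri rmorph1.
have slice_coef z (j : 'I_K) : rat_slice mu phi d z -> rep j = j ->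
    ratr d <= ratr z`_j :> R.
  move=> [z1 zd] rj; rewrite block_seminormE in z1.
  have zle i : ratr z`_i <= 1 :> R.
    by rewrite (le_trans (ler_norm _))// (le_trans (coef_le_block_norm R t _ _))// ltW.
  have h : 1 - ratr z`_j <= \sum_(i < K | rep i == i) (1 - ratr z`_i) :> R.
    by rewrite (bigD1 j)/= ?rj ?eqxx// lerDl sumr_ge0// => i _; rewrite subr_ge0.
  rewrite sumrB sum_c in h.
  move: zd; rewrite /phi ltr_pdivlMr// => zd.
  have e : (1 - 2 * ratr d) * c%:R = c%:R - 1 + ratr d :> R.
    by rewrite dE; field; rewrite gt_eqF// addr_gt0// mulr_gt0.
  by move: zd; rewrite e; lra.
rewrite !big_ord1 scale1r mulr1 block_seminormE.
have D1 : ratr d < 1 :> R by rewrite ratr_lt1.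
apply: block_norm_le => [|b]; first by lra.
pose L := maxn K (maxn (size (x ord0)) (size (y ord0))).
have KL : (K <= L)%N by exact: leq_maxl.
have xL : (size (x ord0) <= L)%N by rewrite !leq_max leqnn orbT.
have yL : (size (y ord0) <= L)%N by rewrite !leq_max leqnn !orbT.
have xyL : (size (x ord0 - y ord0)%R <= L)%N.
  by rewrite (leq_trans (size_polyD _ _))// size_polyN geq_max xL.
rewrite (@blockE _ _ L)//.
have [[i ti]|nb] := pselect (exists i, t i = b); last first.
  by rewrite big1 => [|i /eqP ti]; [lra|case: nb; exists i].
pose j : 'I_L := widen_ord KL (Ordinal (rep_lt i)).
have tj : t j == b by rewrite /= t_rep ti.
have [x1 xc] : block R t b (x ord0) < 1 /\ ratr d <= ratr (x ord0)`_j :> R.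
  split; last by apply: (slice_coef _ (Ordinal (rep_lt i)) (xS ord0)); exact: rep_rep.
  by apply: le_lt_trans (block_le_norm _ _ _ _) _; rewrite -block_seminormE; exact: (xS ord0).1.
have [y1 yc] : block R t b (y ord0) < 1 /\ ratr d <= ratr (y ord0)`_j :> R.
  split; last by apply: (slice_coef _ (Ordinal (rep_lt i)) (yS ord0)); exact: rep_rep.
  by apply: le_lt_trans (block_le_norm _ _ _ _) _; rewrite -block_seminormE; exact: (yS ord0).1.
move: x1 y1; rewrite !(@blockE _ _ L)// !(bigD1 j tj)/=.
have dR : 0 < ratr d :> R by rewrite ltr0q.
have h : \sum_(i0 < L | (t i0 == b) && (i0 != j)) `|ratr (x ord0 - y ord0)`_i0| <=
    \sum_(i0 < L | (t i0 == b) && (i0 != j)) `|ratr (x ord0)`_i0| +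
    \sum_(i0 < L | (t i0 == b) && (i0 != j)) `|ratr (y ord0)`_i0| :> R.
  by rewrite -big_split/=; apply: ler_sum => k _; rewrite coefB rmorphB ler_normB.
move: h xc yc; set Sx := \sum_(_ < L | _) `|ratr (x ord0)`_ _|.
set Sy := \sum_(_ < L | _) `|ratr (y ord0)`_ _|.
set S := \sum_(_ < L | _) _; rewrite /= coefB rmorphB/=.
move=> h xc yc.
rewrite (ger0_norm (le_trans (ltW dR) xc)) (ger0_norm (le_trans (ltW dR) yc)).
(* Both entries are at least d, so their difference loses 2d against their sum; the block of [x - y]
   stays below 2 - 2d. *)
have : `|ratr (x ord0)`_(rep i) - ratr (y ord0)`_(rep i)| <=
    ratr (x ord0)`_(rep i) + ratr (y ord0)`_(rep i) - 2 * ratr d :> R.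
  by rewrite ler_norml; lra.
lra.
Qed.

End Bounded_blocks.

(** * Open and G_delta sets in zero-dimensional Polish spaces *)

(** For each point [a] of a countable dense set and each k, one clopen subset of U containing the
    ball of radius 1/(k+1) about [a] is chosen, if there is any. These balls already cover U. *)
Lemma clopen_cover (R : realType) (Y : topologicalType) (U : set Y) :
  polish R Y -> zero_dim Y -> open U ->
  exists A : nat -> set Y, (forall m, clopen (A m)) /\ U = \bigcup_m A m.
Proof.
move=> [[D [cD dD]] [d [d0 [dC [dT [dO _]]]]]] zd oU.
have /countable_injP[f finj] := cD.
pose P (ak : nat * nat) (C : set Y) := [/\ clopen C, C `<=` U &
  exists2 a, D a /\ f a = ak.1 & [set z | d a z < ak.2.+1%:R^-1] `<=` C].
have ball_nbhs (x : Y) (e : R) : 0 < e -> nbhs x [set z | d x z < e].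
  move=> e0; apply: open_nbhs_nbhs; split; last by rewrite /= (d0 x x).2.
  apply/dO => y /= xy; exists (e - d x y); first by rewrite subr_gt0.
  by move=> z /= yz; rewrite (le_lt_trans (dT x y z))// -ltrBrDl.
exists (fun m => if unpickle m is Some ak then xget set0 (P ak) else set0); split.
  move=> m; case: unpickle => [ak|]; last exact: clopen0.
  by case: xgetP => [C _ []//|_]; exact: clopen0.
apply/seteqP; split => [x Ux|x [m _]]; last first.
  by case: unpickle => // ak; case: xgetP => // C _ [_ CU _] /CU.
have [C [clC [Cx CU]]] := zd x U oU Ux.
have [e e0 eC] := (dO C).1 clC.1 x Cx.
(* Half of e: a dense point within 1/(k+1) of [x] has its own ball of that radius inside the e-ball
   of [x]. *)
have [k ke] : exists k : nat, k.+1%:R^-1 < e / 2 :> R.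
  have [k _ /(_ k (leqnn k))] := near_infty_natSinv_lt (PosNum (divr_gt0 e0 (ltr0n R 2))).
  by exists k.
have k0 : 0 < k.+1%:R^-1 :> R by rewrite invr_gt0.
have : closure D x by rewrite dD.
move=> /(_ _ (ball_nbhs x _ k0))[a [Da /= xa]].
exists (pickle (f a, k)) => //; rewrite pickleK.
have PC : P (f a, k) C.
  split => //; exists a => // z /= az; apply: eC => /=.
  by rewrite (le_lt_trans (dT x a z))// (splitr e) ltrD// (lt_trans _ ke).
(* The chosen set may differ from [C], but it contains the same ball, as [f] is injective on [D],
   and hence [x]. *)
case: xgetP => [C' _ [_ _ [a' [Da' faa'] aC']]|/(_ C)//].
apply: aC' => /=; rewrite dC; suff -> : a' = a by [].
by apply: finj; rewrite ?inE.
Qed.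

Lemma clopen_near (Y : topologicalType) (A : set Y) (y : Y) :
  clopen A -> \forall z \near y, A z <-> A y.
Proof.
move=> [oA cA]; have [Ay|nAy] := pselect (A y).
  by have := open_nbhs_nbhs (conj oA Ay); apply: filterS => z; split.
have := open_nbhs_nbhs (conj (closed_openC cA) nAy).
by apply: filterS => z nAz; split.
Qed.

(** C is the intersection of decreasing open sets [O n], each a union of clopen sets [A n m]. The
    coordinate coded by (n, m) takes the value n + 1 on [A n m], so unboundedness means membership
    in [O n] for arbitrarily large n, hence for all n. *)
Lemma unbounded_reduction (R : realType) (Y : topologicalType) (C : set Y) :
  polish R Y -> zero_dim Y -> Gdelta C ->
  exists t : Y -> nat -> nat,
    (forall k y, \forall z \near y, t z k = t y k) /\
    (forall y, C y <-> forall B, exists k, (B <= t y k)%N).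
Proof.
move=> pY zY [F oF ->].
pose O n : set Y := [set y | forall i, (i <= n)%N -> F i y].
have oO n : open (O n).
  elim: n => [|n IH].
    rewrite (_ : O 0%N = F 0%N)//; apply/seteqP; split => [y /(_ 0%N)|y Fy i]; first exact.
    by rewrite leqn0 => /eqP ->.
  rewrite (_ : O n.+1 = O n `&` F n.+1); first exact: openI.
  apply/seteqP; split => [y Oy|y [Oy Fy] i].
    by split => [i /leqW|]; exact: Oy.
  by rewrite leq_eqVlt => /orP[/eqP->//|]; exact: Oy.
have /choice[A AP] n := clopen_cover pY zY (oO n).
pose t (y : Y) (k : nat) :=
  if unpickle k is Some (n, m) then if `[< A n m y >] then n.+1 else 0%N else 0%N.
exists t; split => [k y|y].
  rewrite /t; case: unpickle => [[n m]|]; last exact: nearW.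
  have := clopen_near y ((AP n).1 m); apply: filterS => z Azy.
  by rewrite (asbool_equiv_eq Azy).
split => [Cy B|ty n _].
  have : O B y by move=> i _; exact: Cy.
  rewrite (AP B).2 => -[m _ Am]; exists (pickle (B, m)).
  by rewrite /t pickleK asboolT.
(* The bound n + 1 excludes the value 0 of non-membership and yields an index i >= n. *)
have [k] := ty n.+1; rewrite /t; case: unpickle => [[i m]|]//.
case: asboolP => // Aim; rewrite ltnS => ni.
have : O i y by rewrite (AP i).2; exists m.
exact.
Qed.

(** The value at a fixed [v] depends on finitely many coordinates of [t y], so it is locally
    constant in [y]. *)
Lemma block_seminorm_continuous (R : realType) (Y : topologicalType)
    (t : Y -> nat -> nat) :
  (forall k y, \forall z \near y, t z k = t y k) ->
  continuous (fun y => block_seminorm R (t y) : RV R).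
Proof.
move=> tloc y; apply/cvg_sup => v U [W [[S oS <-] SW WU]].
apply: filterS WU _; rewrite /=.
have : \forall z \near y, forall k : 'I_(size (toP v)), t z k = t y k.
  by apply: filter_forall => k; exact: tloc.
apply: filterS => z tz.
have e : block_seminorm R (t z) v = block_seminorm R (t y) v.
  rewrite /block_seminorm /block_norm; apply: eq_bigr => k _; rewrite tz.
  by apply: eq_bigl => i; rewrite tz.
by move: SW; rewrite /= e.
Qed.

Theorem theorem5p6 (R : realType) (I : set (RV R)) :
  I = Pset R \/ I = Pinf R \/ I = Bset R ->
  Gdelta_complete R I (I `&` SD2Pset R).
Proof.
(* The reduction takes values in the smallest class and the G_delta description holds on the largest
   one, so all three cases are treated at once. *)
move=> IE; have [BI IP] : Bset R `<=` I /\ I `<=` Pset R.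
  by case: IE => [|[|]] ->; split => // mu; [case=> [[]]|case|case|case=> [[]]].
split.
  exists [set mu | ~ has_small_slices mu]; split; first exact: no_small_slices_Gdelta.
  by apply/seteqP; split => mu [Imu]; move: (SD2PsetP (IP _ Imu)) => h /h.
move=> Y pY zY C GC; have [t [tloc tC]] := unbounded_reduction pY zY GC.
exists (fun y => block_seminorm R (t y)); split; first exact: block_seminorm_continuous.
have It y : I (block_seminorm R (t y)) by apply: BI; exact: block_seminorm_Bset.
split => //; apply/seteqP; split => y.
  move=> [_ /(SD2PsetP (block_seminormP R (t y))) ns]; apply/tC => B.
  apply: contrapT => /forallNP tB; apply: ns; apply: bounded_small_slices.
  by exists B => i; rewrite ltnNge; apply/negP.
move=> /tC/unbounded_no_small_slices ns; split => //.
by apply/SD2PsetP; [exact: block_seminormP|exact: ns].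
Qed.
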